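(* Let $L$ be an $n$-dimensional nilpotent Lie algebra over a field $\mathbb{F}$, with $n\geq 1$, let $d$ be the minimal number of generators of $L/Z(L)$, and let $t(L)=d\,\dim L^{2}-\dim L/Z(L)$. Then: (i) $t(L)=0$ if and only if $L$ is isomorphic to $A(n)$, or to $H(m)\oplus A(n-2m-1)$ for some integer $m\geq 1$ with $2m+1\leq n$; (ii) $t(L)=1$ if and only if $n\geq 4$ and $L$ is isomorphic to $L_{4,3}\oplus A(n-4)$; (iii) $t(L)=2$ if and only if $n\geq 5$ and $L$ is isomorphic to one of $L_{5,5}\oplus A(n-5)$, $L_{5,6}\oplus A(n-5)$, $L_{5,7}\oplus A(n-5)$.
   Context: Lie algebras are finite dimensional over an arbitrary field $\mathbb{F}$. $L^{2}=[L,L]$ is the derived subalgebra and $Z(L)$ is the center of $L$. The minimal number of generators of a Lie algebra is the smallest cardinality of a set generating it as a Lie algebra (so it is $0$ for the zero algebra). For a finite dimensional nilpotent Lie algebra $L$, with $d$ the minimal number of generators of $L/Z(L)$, the integer $t(L)$ is defined by $\dim L/Z(L)=d\,\dim L^{2}-t(L)$; it is a known fact that $t(L)\geq 0$. $A(k)$ denotes the abelian Lie algebra of dimension $k$ ($A(0)=0$). $H(m)$ denotes the Heisenberg Lie algebra of dimension $2m+1$, with basis $x_1,y_1,\dots,x_m,y_m,z$ and nonzero brackets of basis elements (up to antisymmetry) $[x_i,y_i]=z$ for $1\leq i\leq m$. The following Lie algebras are given by a basis and the nonzero brackets of basis elements (all brackets not listed and not obtained by antisymmetry are zero): $L_{4,3}=\langle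 x_1,\dots,x_4 \mid [x_1,x_2]=x_3,\ [x_1,x_3]=x_4\rangle$; $L_{5,5}=\langle x_1,\dots,x_5 \mid [x_1,x_2]=x_3,\ [x_1,x_3]=x_5,\ [x_2,x_4]=x_5\rangle$; $L_{5,6}=\langle x_1,\dots,x_5 \mid [x_1,x_2]=x_3,\ [x_1,x_3]=x_4,\ [x_1,x_4]=x_5,\ [x_2,x_3]=x_5\rangle$; $L_{5,7}=\langle x_1,\dots,x_5 \mid [x_1,x_2]=x_3,\ [x_1,x_3]=x_4,\ [x_1,x_4]=x_5\rangle$. *)

(* Defs.v *)
From HB Require Import structures.
From mathcomp Require Import all_boot all_order all_algebra.
From mathcomp Require Import ring.

Set Implicit Arguments.
Unset Strict Implicit.
Unset Printing Implicit Defensive.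

Import GRing.Theory VectorInternalTheory.
Local Open Scope ring_scope.
Local Open Scope quotient_scope.

Reserved Notation "\[ x , y ]" (at level 0, x, y at level 99,
  format "\[ x ,  y ]").

HB.mixin Record isLieAlgebra (F : fieldType) (L : Type) of Vector F L := {
  bracket : L -> L -> L;
  bracket_linearl : forall y, linear (fun x => bracket x y);
  bracket_linearr : forall x, linear (bracket x);
  bracketxx : forall x, bracket x x = 0;
  jacobi : forall x y z,
    bracket x (bracket y z) + bracket y (bracket z x)
      + bracket z (bracket x y) = 0 }.

#[short(type="lieAlgType")]
HB.structure Definition LieAlgebra (F : fieldType) :=
  { L of isLieAlgebra F L & Vector F L }.

Notation "\[ x , y ]" := (bracket x y) : ring_scope.

Section BracketTheory.
Variables (F : fieldType) (L : lieAlgType F).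
Implicit Types x y z : L.

Definition bracketr y x := \[x, y].
HB.instance Definition _ y :=
  GRing.isLinear.Build F L L _ (bracketr y) (bracket_linearl y).
HB.instance Definition _ x :=
  GRing.isLinear.Build F L L _ (@bracket F L x) (@bracket_linearr F L x).

Lemma bracketDl x x' y : \[x + x', y] = \[x, y] + \[x', y].
Proof. exact: (linearD (bracketr y)). Qed.
Lemma bracketDr x y y' : \[x, y + y'] = \[x, y] + \[x, y'].
Proof. exact: linearD. Qed.
Lemma bracketZl a x y : \[a *: x, y] = a *: \[x, y].
Proof. exact: (linearZ_LR (bracketr y)). Qed.
Lemma bracketZr a x y : \[x, a *: y] = a *: \[x, y].
Proof. exact: linearZ_LR. Qed.
Lemma bracketBl x x' y : \[x - x', y] = \[x, y] - \[x', y].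
Proof. exact: (linearB (bracketr y)). Qed.
Lemma bracketBr x y y' : \[x, y - y'] = \[x, y] - \[x, y'].
Proof. exact: linearB. Qed.
Lemma bracketr0 x : \[x, 0] = 0. Proof. exact: linear0. Qed.
Lemma bracket0r x : \[0, x] = 0.
Proof. exact: (linear0 (bracketr x)). Qed.

Lemma bracket_suml I (r : seq I) (P : pred I) (f : I -> L) y :
  \[\sum_(i <- r | P i) f i, y] = \sum_(i <- r | P i) \[f i, y].
Proof. exact: (linear_sum (bracketr y)). Qed.
Lemma bracket_sumr I (r : seq I) (P : pred I) (f : I -> L) x :
  \[x, \sum_(i <- r | P i) f i] = \sum_(i <- r | P i) \[x, f i].
Proof. exact: linear_sum. Qed.

Lemma bracketC x y : \[x, y] = - \[y, x].
Proof.
have := bracketxx (x + y); rewrite bracketDl !bracketDr !bracketxx add0r addr0.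
by move/eqP; rewrite addr_eq0 => /eqP.
Qed.

Definition bracket_space (U V : {vspace L}) : {vspace L} :=
  <<[seq \[u, v] | u <- vbasis U, v <- vbasis V]>>%VS.

Lemma bracket_spaceP (U V W : {vspace L}) :
  reflect {in U & V, forall u v, \[u, v] \in W} (bracket_space U V <= W)%VS.
Proof.
apply: (iffP span_subvP) => [sW u v Uu Vv | sW w].
  rewrite (coord_vbasis Uu) (coord_vbasis Vv).
  rewrite bracket_suml memv_suml // => i _.
  rewrite bracketZl memvZ // bracket_sumr memv_suml // => j _.
  rewrite bracketZr memvZ //; apply/sW/allpairs_f;
  by rewrite mem_nth ?size_tuple.
by case/allpairsP=> -[u v] /= [/vbasis_mem Uu /vbasis_mem Vv ->]; apply: sW.
Qed.

Lemma mem_bracket_space (U V : {vspace L}) u v :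
  u \in U -> v \in V -> \[u, v] \in bracket_space U V.
Proof. by move=> Uu Vv; apply/(bracket_spaceP U V) => //; apply: subvv. Qed.

Fixpoint lower_central (k : nat) : {vspace L} :=
  if k is k'.+1 then bracket_space fullv (lower_central k') else fullv.

Definition nilpotent_lie : Prop := exists k, lower_central k = 0%VS.

Definition is_subalgebra (U : {vspace L}) : Prop :=
  {in U &, forall u v, \[u, v] \in U}.

(* A generates L: no proper Lie subalgebra contains A. *)
Definition lie_generates (A : seq L) : Prop :=
  forall U : {vspace L}, is_subalgebra U -> {subset A <= U} -> U = fullv.

(* Duplicate-free sequences stand for the finite subsets of L, the only ones
   that matter since L is finite dimensional. *)
Definition is_min_num_generators (d : nat) : Prop :=
  (exists A : seq L, [/\ uniq A, lie_generates A & size A = d]) /\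
  (forall A : seq L, uniq A -> lie_generates A -> (d <= size A)%N).

End BracketTheory.

Arguments lower_central {F} L k.
Arguments nilpotent_lie {F} L.
Arguments is_min_num_generators {F} L d.

Definition derived_alg (F : fieldType) (L : lieAlgType F) : {vspace L} :=
  bracket_space fullv fullv.

Definition lie_isog (F : fieldType) (L M : lieAlgType F) : Prop :=
  exists f : {linear L -> M},
    bijective f /\ forall x y : L, f \[x, y] = \[f x, f y].

Record lie_ideal (F : fieldType) (L : lieAlgType F) := LieIdeal {
  ideal_space :> {vspace L};
  ideal_bracket : forall x y, y \in ideal_space -> \[x, y] \in ideal_space }.

(* The set of cosets x + I. *)
Definition lie_quot (F : fieldType) (L : lieAlgType F) (I : lie_ideal L) :=
  Quotient.quot (ideal_space I).

Section Quotient.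
Variables (F : fieldType) (L : lieAlgType F) (I : lie_ideal L).
Local Notation Q := (lie_quot I).

HB.instance Definition _ := GRing.Zmodule.on Q.
HB.instance Definition _ := ZmodQuotient.on Q.

Lemma quot_eqP (x y : L) : reflect (\pi_Q x = \pi_Q y) (x - y \in ideal_space I).
Proof. by rewrite Quotient.idealrBE; apply: eqP. Qed.

Definition quot_scale (a : F) (u : Q) : Q := \pi_Q (a *: repr u).

Lemma repr_quot (x : L) : repr (\pi_Q x) - x \in ideal_space I.
Proof. by apply/quot_eqP; rewrite reprK. Qed.

Lemma pi_quot_scale a x : \pi_Q (a *: x) = quot_scale a (\pi_Q x).
Proof. by apply/esym/quot_eqP; rewrite -scalerBr memvZ ?repr_quot. Qed.

Fact quot_scaleA a b u : quot_scale a (quot_scale b u) = quot_scale (a * b) u.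
Proof.
by rewrite -[u]reprK -(pi_quot_scale b) -(pi_quot_scale a) -pi_quot_scale scalerA.
Qed.
Fact quot_scale1 : left_id 1 quot_scale.
Proof. by move=> u; rewrite -[u]reprK -!pi_quot_scale scale1r. Qed.
Fact quot_scaleDr : right_distributive quot_scale +%R.
Proof.
move=> a u v; rewrite -[u]reprK -[v]reprK.
by rewrite -pi_addr -!pi_quot_scale scalerDr pi_addr.
Qed.
Fact quot_scaleDl u : {morph quot_scale^~ u : a b / a + b}.
Proof. by move=> a b; rewrite -[u]reprK -!pi_quot_scale scalerDl pi_addr. Qed.

HB.instance Definition _ := GRing.Zmodule_isLmodule.Build F Q
  quot_scaleA quot_scale1 quot_scaleDr quot_scaleDl.

Lemma pi_quot_linear : linear (\pi_Q : L -> Q).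
Proof. by move=> a x y; rewrite pi_addr pi_quot_scale. Qed.


Let W := (ideal_space I)^C%VS.
Let coinv (x : L) : subvs_of W := vsproj W (x - projv (ideal_space I) x).

Let coinv_linear : linear coinv.
Proof.
move=> a x y; rewrite /coinv -linearP scalerBr linearP opprD /=.
by congr vsproj; rewrite addrACA.
Qed.

Let pi_coinv x : \pi_Q (vsval (coinv x)) = \pi_Q x.
Proof.
apply/quot_eqP; rewrite vsprojK ?memv_projC // addrAC subrr add0r.
by rewrite rpredN memv_proj.
Qed.

Let coinv_eq x y : \pi_Q x = \pi_Q y -> coinv x = coinv y.
Proof.
move/quot_eqP=> Ixy; rewrite /coinv; congr vsproj.
have eq_proj := projv_id Ixy; rewrite linearB /= in eq_proj.
by apply/eqP; rewrite subr_eq addrAC -addrA eq_proj addrC subrK.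
Qed.

Fact quot_vect_iso : Vector.axiom (dim (subvs_of W)) Q.
Proof.
exists (fun u : Q => v2r (coinv (repr u))).
  move=> a u v; rewrite -linearZ -linearD -coinv_linear; congr v2r.
  by apply: coinv_eq; rewrite reprK pi_quot_linear !reprK.
exists (fun r => \pi_Q (vsval (r2v r : subvs_of W))) => [u | r].
  by rewrite v2rK pi_coinv reprK.
rewrite (coinv_eq (reprK _)) /coinv -[RHS]r2vK; congr v2r.
rewrite linearB /= vsvalK; set w := r2v r.
suff -> : projv (ideal_space I) (vsval w) = 0 by rewrite linear0 subr0.
apply/eqP; rewrite -memv0 -(capv_compl (ideal_space I)) memv_cap memv_proj /=.
by rewrite -[X in X \in _](subKr (vsval w)) rpredB ?memv_projC ?subvsP.
Qed.
HB.instance Definition _ := Lmodule_hasFinDim.Build F Q quot_vect_iso.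

Definition quot_bracket (u v : Q) : Q := \pi_Q \[repr u, repr v].

Lemma pi_quot_bracket x y : \pi_Q \[x, y] = quot_bracket (\pi_Q x) (\pi_Q y).
Proof.
apply/esym/quot_eqP; set x' := repr _; set y' := repr _.
have -> : \[x', y'] - \[x, y] = \[x', y' - y] - \[y, x' - x].
  rewrite !bracketBr [\[y, x']]bracketC [\[y, x]]bracketC opprB opprK.
  by rewrite [_ + \[x', y]]addrC addrA subrK.
by rewrite rpredB ?ideal_bracket ?repr_quot.
Qed.

Fact quot_bracket_linearl v : linear (fun u => quot_bracket u v).
Proof.
move=> a u w; rewrite -[u]reprK -[v]reprK -[w]reprK -pi_quot_linear.
by rewrite -!pi_quot_bracket bracketDl bracketZl pi_quot_linear.
Qed.

Fact quot_bracket_linearr u : linear (quot_bracket u).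
Proof.
move=> a v w; rewrite -[u]reprK -[v]reprK -[w]reprK -pi_quot_linear.
by rewrite -!pi_quot_bracket bracketDr bracketZr pi_quot_linear.
Qed.

Fact quot_bracketxx u : quot_bracket u u = 0.
Proof. by rewrite /quot_bracket bracketxx pi_zeror. Qed.

Fact quot_jacobi u v w :
  quot_bracket u (quot_bracket v w) + quot_bracket v (quot_bracket w u)
    + quot_bracket w (quot_bracket u v) = 0.
Proof.
rewrite -[u]reprK -[v]reprK -[w]reprK; move: (repr u) (repr v) (repr w) => x y z.
rewrite -(pi_quot_bracket y z) -(pi_quot_bracket z x) -(pi_quot_bracket x y).
rewrite -(pi_quot_bracket x \[y, z]) -(pi_quot_bracket y \[z, x]).
by rewrite -(pi_quot_bracket z \[x, y]) -!pi_addr jacobi pi_zeror.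
Qed.

HB.instance Definition _ := isLieAlgebra.Build F Q
  quot_bracket_linearl quot_bracket_linearr quot_bracketxx quot_jacobi.

End Quotient.

Section Center.
Variables (F : fieldType) (L : lieAlgType F).

Definition ad (x : L) : 'End(L) := linfun (@bracket F L x).

Fact ad_linear : linear ad.
Proof.
move=> a x y; apply/lfunP=> z.
by rewrite add_lfunE scale_lfunE !lfunE /= bracketDl bracketZl.
Qed.
HB.instance Definition _ := GRing.isLinear.Build F L 'End(L) _ ad ad_linear.

Definition center_space : {vspace L} := lker (linfun ad).

Lemma center_spaceP x : reflect (forall y, \[x, y] = 0) (x \in center_space).
Proof.
rewrite memv_ker lfunE /=; apply: (iffP eqP) => [adx0 y | Zx].
  by have /lfunP/(_ y) := adx0; rewrite lfunE zero_lfunE.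
by apply/lfunP=> y; rewrite lfunE zero_lfunE /= Zx.
Qed.

Fact center_bracket (x y : L) : y \in center_space -> \[x, y] \in center_space.
Proof. by move/center_spaceP=> Zy; rewrite bracketC Zy oppr0 mem0v. Qed.

Definition lie_center : lie_ideal L := LieIdeal center_bracket.

End Center.

Arguments lie_center {F} L.

(* To be used with d the minimal number of generators of L/Z(L). *)
Definition t_invariant (F : fieldType) (L : lieAlgType F) (d : nat) : int :=
  d%:Z * (\dim (derived_alg L))%:Z - (\dim {:lie_quot (lie_center L)})%:Z.

Section DirectSum.
Variables (F : fieldType) (L M : lieAlgType F).

Definition pair_bracket (u v : L * M) : L * M := (\[u.1, v.1], \[u.2, v.2]).

Fact pair_bracket_linearl v : linear (fun u => pair_bracket u v).
Proof. by move=> a u w; congr pair; rewrite bracketDl bracketZl. Qed.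

Fact pair_bracket_linearr u : linear (pair_bracket u).
Proof. by move=> a v w; congr pair; rewrite bracketDr bracketZr. Qed.

Fact pair_bracketxx u : pair_bracket u u = 0.
Proof. by rewrite /pair_bracket !bracketxx. Qed.

Fact pair_jacobi u v w :
  pair_bracket u (pair_bracket v w) + pair_bracket v (pair_bracket w u)
    + pair_bracket w (pair_bracket u v) = 0.
Proof. by congr pair; apply: jacobi. Qed.

HB.instance Definition _ := isLieAlgebra.Build F (L * M)%type
  pair_bracket_linearl pair_bracket_linearr pair_bracketxx pair_jacobi.

End DirectSum.

Section StructureTable.
Variables (F : fieldType) (n : nat).
Implicit Types u v w : 'rV[F]_n.+1.

(* Basis vectors are numbered x_1, ..., x_(n.+1); only indices in this range
   are meaningful. *)
Definition basis_vec (k : nat) : 'rV[F]_n.+1 := delta_mx 0 (inord k.-1).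
Definition coef u (k : nat) : F := u 0 (inord k.-1).

(* The alternating bilinear map with [x_i, x_j] = x_k for each ((i, j), k) in
   the table s, and zero on the pairs of basis vectors not listed in s. *)
Definition table_bracket (s : seq (nat * nat * nat)) u v : 'rV[F]_n.+1 :=
  \sum_(t <- s) (coef u t.1.1 * coef v t.1.2 - coef u t.1.2 * coef v t.1.1)
                  *: basis_vec t.2.

Lemma coefP a u v k : coef (a *: u + v) k = a * coef u k + coef v k.
Proof. by rewrite /coef !mxE. Qed.

Lemma table_bracket_linearl s v : linear (fun u => table_bracket s u v).
Proof.
move=> a u w; rewrite /table_bracket scaler_sumr -big_split /=.
apply: eq_bigr => t _; rewrite !coefP scalerA -scalerDl; congr (_ *: _); ring.
Qed.

Lemma table_bracket_linearr s u : linear (table_bracket s u).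
Proof.
move=> a v w; rewrite /table_bracket scaler_sumr -big_split /=.
apply: eq_bigr => t _; rewrite !coefP scalerA -scalerDl; congr (_ *: _); ring.
Qed.

Lemma table_bracketxx s u : table_bracket s u u = 0.
Proof. by apply: big1 => t _; rewrite mulrC subrr scale0r. Qed.

End StructureTable.

Definition abelian_lie (F : fieldType) (k : nat) : Type := 'rV[F]_k.

Section Abelian.
Variables (F : fieldType) (k : nat).
Local Notation A := (abelian_lie F k).

HB.instance Definition _ := Vector.on A.

Definition abelian_bracket (u v : A) : A := 0.

Fact abelian_bracket_linear v : linear (abelian_bracket v).
Proof. by move=> a u w; rewrite /abelian_bracket scaler0 addr0. Qed.

Fact abelian_jacobi u v w :
  abelian_bracket u (abelian_bracket v w)
    + abelian_bracket v (abelian_bracket w u)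
    + abelian_bracket w (abelian_bracket u v) = 0.
Proof. by rewrite /abelian_bracket !addr0. Qed.

HB.instance Definition _ := isLieAlgebra.Build F A
  abelian_bracket_linear abelian_bracket_linear (fun _ => erefl) abelian_jacobi.

End Abelian.

(* Here x_i, y_i and z are the basis vectors numbered 2i-1, 2i and 2m+1. *)
Definition heisenberg_table (m : nat) : seq (nat * nat * nat) :=
  [seq ((2 * i).-1, 2 * i, (2 * m).+1)%N | i <- iota 1 m].

Definition heisenberg (F : fieldType) (m : nat) : Type := 'rV[F]_(2 * m).+1.

Section Heisenberg.
Variables (F : fieldType) (m : nat).
Local Notation H := (heisenberg F m).
Local Notation br := (table_bracket (heisenberg_table m)).

HB.instance Definition _ := Vector.on H.

Lemma heisenberg_nil2 (u v w : 'rV[F]_(2 * m).+1) : br u (br v w) = 0.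
Proof.
have br0 k : (k.-1 < 2 * m)%N -> coef (br v w) k = 0.
  move=> ltk; rewrite /coef /table_bracket big_map summxE big1 // => i _.
  rewrite /basis_vec !mxE /= -val_eqE /= !inordK ?(leqW ltk) //.
  by rewrite (ltn_eqF ltk) mulr0.
rewrite {1}/table_bracket big_map big1_seq //= => i.
rewrite mem_iota add1n ltnS => /andP[i_gt0 lei].
have lt1 : ((2 * i).-1 < 2 * m)%N by rewrite prednK ?muln_gt0 ?leq_mul2l.
by rewrite !br0 ?mulr0 ?subr0 ?scale0r // (leq_ltn_trans (leq_pred _)).
Qed.

Fact heisenberg_jacobi (u v w : 'rV[F]_(2 * m).+1) :
  br u (br v w) + br v (br w u) + br w (br u v) = 0.
Proof. by rewrite !heisenberg_nil2 !addr0. Qed.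

HB.instance Definition _ := isLieAlgebra.Build F H
  (table_bracket_linearl _) (table_bracket_linearr _) (table_bracketxx _)
  heisenberg_jacobi.

End Heisenberg.

Definition table_4_3 : seq (nat * nat * nat) :=
  [:: (1, 2, 3); (1, 3, 4)]%N.
Definition table_5_5 : seq (nat * nat * nat) :=
  [:: (1, 2, 3); (1, 3, 5); (2, 4, 5)]%N.
Definition table_5_6 : seq (nat * nat * nat) :=
  [:: (1, 2, 3); (1, 3, 4); (1, 4, 5); (2, 3, 5)]%N.
Definition table_5_7 : seq (nat * nat * nat) :=
  [:: (1, 2, 3); (1, 3, 4); (1, 4, 5)]%N.

Definition L_4_3 (F : fieldType) : Type := 'rV[F]_4.
Definition L_5_5 (F : fieldType) : Type := 'rV[F]_5.
Definition L_5_6 (F : fieldType) : Type := 'rV[F]_5.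
Definition L_5_7 (F : fieldType) : Type := 'rV[F]_5.

Section LowDimension.
Variable F : fieldType.

Definition table_jacobi n (s : seq (nat * nat * nat)) : Prop :=
  forall u v w : 'rV[F]_n.+1,
    table_bracket s u (table_bracket s v w)
      + table_bracket s v (table_bracket s w u)
      + table_bracket s w (table_bracket s u v) = 0.

Ltac expand_table_jacobi s :=
  move=> u v w; apply/rowP=> c; rewrite /table_bracket /s;
  rewrite !big_cons !big_nil !addr0 /coef /basis_vec !mxE /=;
  rewrite -?val_eqE /= ?inordK //=; ring.

Fact jacobi_4_3 : table_jacobi 3 table_4_3.
Proof. expand_table_jacobi table_4_3. Qed.
Fact jacobi_5_5 : table_jacobi 4 table_5_5.
Proof. expand_table_jacobi table_5_5. Qed.
Fact jacobi_5_6 : table_jacobi 4 table_5_6.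
Proof. expand_table_jacobi table_5_6. Qed.
Fact jacobi_5_7 : table_jacobi 4 table_5_7.
Proof. expand_table_jacobi table_5_7. Qed.

HB.instance Definition _ := Vector.on (L_4_3 F).
HB.instance Definition _ := isLieAlgebra.Build F (L_4_3 F)
  (table_bracket_linearl _) (table_bracket_linearr _) (table_bracketxx _)
  jacobi_4_3.
HB.instance Definition _ := Vector.on (L_5_5 F).
HB.instance Definition _ := isLieAlgebra.Build F (L_5_5 F)
  (table_bracket_linearl _) (table_bracket_linearr _) (table_bracketxx _)
  jacobi_5_5.
HB.instance Definition _ := Vector.on (L_5_6 F).
HB.instance Definition _ := isLieAlgebra.Build F (L_5_6 F)
  (table_bracket_linearl _) (table_bracket_linearr _) (table_bracketxx _)
  jacobi_5_6.
HB.instance Definition _ := Vector.on (L_5_7 F).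
HB.instance Definition _ := isLieAlgebra.Build F (L_5_7 F)
  (table_bracket_linearl _) (table_bracket_linearr _) (table_bracketxx _)
  jacobi_5_7.

End LowDimension.

(* Main.v *)
Require Import Defs.
From HB Require Import structures.
From mathcomp Require Import all_boot all_order all_algebra.
From mathcomp Require Import zify.

Set Implicit Arguments.
Unset Strict Implicit.
Unset Printing Implicit Defensive.

Import GRing.Theory.
Local Open Scope ring_scope.

(** Put $m = \dim L^2$ and $c = \dim (L^2 \cap Z(L))$. In a nilpotent Lie
    algebra $L^2$ consists of non-generators ([subalgebra_add_derived]), so the
    minimal number $d$ of generators of $L/Z(L)$ is the codimension of
    $L^2 + Z(L)$ in $L$, and $\dim L/Z(L) = d + m - c$. Hence
    $$t(L) = dm - (d + m - c) = (d-1)(m-1) + (c-1).$$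
    If $L$ is not abelian then $d \geq 2$ and $1 \leq c \leq m$
    ([t_formula_nonabelian]), and a small value of $t(L)$ leaves few triples
    $(d, m, c)$:
    - $t = 0$ forces $m = c = 1$: the bracket is an alternating form with values
      in a central line, and a symplectic basis exhibits a Heisenberg algebra
      ([heisenberg_isog]);
    - $t = 1$ forces $(2,2,1)$, which is $L_{4,3}$ ([isog_L_4_3]);
    - $t = 2$ leaves $(2,3,1)$, which is $L_{5,6}$ or $L_{5,7}$
      ([isog_L_5_6_or_7]), $(3,2,1)$, which is $L_{5,5}$ ([isog_L_5_5]), and
      $(2,2,2)$, which does not occur: a central $L^2$ is spanned by the bracket
      of the two generators.
    In each case generators are adapted to the lower central series so as to
    satisfy a structure table, and a complement of $L^2 \cap Z(L)$ in $Z(L)$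
    supplies the abelian summand ([table_basis_isog]). Conversely the formula for
    $t$ ignores a central direct summand ([t_formula_split]), which leaves its
    value on each table algebra to be computed. *)

(** * Complements on vector spaces and linear maps *)

Section LinearAlgebra.
Variables (F : fieldType) (V W : vectType F).

Lemma memv_add_lineP (x w : V) (U : {vspace V}) :
  reflect (exists a, exists2 u, u \in U & w = a *: x + u) (w \in (<[x]> + U)%VS).
Proof.
apply: (iffP memv_addP) => [[_ /vlineP[a ->] [u Uu ->]] | [a [u Uu ->]]].
  by exists a, u.
by exists (a *: x); [apply/vlineP; exists a | exists u].
Qed.

Lemma dim1_vline (U : {vspace V}) x : \dim U = 1%N -> x \in U -> x != 0 -> U = <[x]>%VS.
Proof.
move=> dimU Ux x0; apply/eqP; rewrite eq_sym eqEdim -memvE Ux dimU.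
by rewrite dim_vline x0.
Qed.

Lemma proper_dim_lt (U U' : {vspace V}) :
  (U <= U')%VS -> U != U' -> (\dim U < \dim U')%N.
Proof.
move=> sUU' neq; rewrite ltn_neqAle (dimvS sUU') andbT.
by apply: contraNneq neq => eqd; rewrite eqEdim sUU' eqd leqnn.
Qed.

Lemma vline_addE (x : V) (U U' : {vspace V}) :
    (U' <= U)%VS -> x \in U -> x \notin U' -> \dim U = (\dim U').+1 ->
  U = (<[x]> + U')%VS.
Proof.
move=> U'U Ux nU'x dimU; apply/eqP; rewrite eq_sym eqEdim subv_add -memvE Ux U'U dimU /=.
rewrite -addn1 addnC dimv_disjoint_sum.
  rewrite dim_vline; case: eqP => // x0; by rewrite x0 mem0v in nU'x.
apply/eqP; rewrite -subv0; apply/subvP=> w /memv_capP[/vlineP[a ->] U'ax].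
have [-> | a0] := eqVneq a 0; first by rewrite scale0r mem0v.
by case/negP: nU'x; rewrite -[x]scale1r -(mulVf a0) -scalerA memvZ.
Qed.

Lemma linear_fun_limg (g : {linear V -> W}) (U : {vspace V}) w :
  reflect (exists2 u, u \in U & w = g u) (w \in (linfun g @: U)%VS).
Proof.
by apply: (iffP memv_imgP) => -[u Uu ->]; exists u; rewrite ?lfunE.
Qed.

Lemma dim_limg_inj (g : {linear V -> W}) (U : {vspace V}) :
  injective g -> \dim (linfun g @: U) = \dim U.
Proof.
move=> injg; apply: limg_dim_eq; apply/eqP; rewrite -subv0.
apply/subvP=> u /memv_capP[_]; rewrite memv_ker lfunE memv0 => /eqP gu0.
by apply/eqP/injg; rewrite gu0 linear0.
Qed.

End LinearAlgebra.

(** * Nilpotent Lie algebras and their generators *)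

Section NilpotentTheory.
Variables (F : fieldType) (L : lieAlgType F).
Implicit Types (U V W I : {vspace L}) (x y z : L).

Local Notation Z := (center_space L).
Local Notation L2 := (derived_alg L).

Lemma mem_derived x y : \[x, y] \in L2.
Proof. exact: mem_bracket_space (memvf x) (memvf y). Qed.

Lemma bracket_central x z : z \in Z -> \[x, z] = 0.
Proof. by move/center_spaceP=> Zz; rewrite bracketC Zz oppr0. Qed.

Lemma central_bracket x z : z \in Z -> \[z, x] = 0.
Proof. by move/center_spaceP. Qed.

Lemma bracket_spaceS U U' V V' :
  (U <= U')%VS -> (V <= V')%VS -> (bracket_space U V <= bracket_space U' V')%VS.
Proof.
move=> /subvP sU /subvP sV; apply/bracket_spaceP=> u v Uu Vv.
by apply: mem_bracket_space; [apply: sU | apply: sV].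
Qed.

Lemma lower_centralS k : (lower_central L k.+1 <= lower_central L k)%VS.
Proof.
elim: k => [|k IHk]; first exact: subvf.
by apply: bracket_spaceS => //; apply: subvv.
Qed.

Lemma mem_lower_centralS k x y :
  y \in lower_central L k -> \[x, y] \in lower_central L k.+1.
Proof. exact/mem_bracket_space/memvf. Qed.

Hypothesis nilL : nilpotent_lie L.

Lemma lower_central_proper k :
  lower_central L k != 0%VS -> lower_central L k.+1 != lower_central L k.
Proof.
apply: contraNneq => stat; have [K LK0] := nilL.
have lc_const j : lower_central L (j + k)%N = lower_central L k.
  by elim: j => //= j ->.
rewrite -(lc_const K) -subv0 -LK0; elim: k {stat lc_const} => [|k IHk].
  by rewrite addn0 subvv.
by rewrite addnS (subv_trans _ IHk) ?lower_centralS.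
Qed.

Lemma lower_central_dim_lt k :
  lower_central L k != 0%VS ->
  (\dim (lower_central L k.+1) < \dim (lower_central L k))%N.
Proof.
by move/lower_central_proper; apply: proper_dim_lt; apply: lower_centralS.
Qed.

(** In a nilpotent Lie algebra $[L,L]$ consists of non-generators: if
    $U + L^k = L$ with $U$ a subalgebra, then
    $L^2 = [U + L^k, U + L^k]$ is contained in $U + L^{k+1}$, so one can
    climb down the lower central series. *)
Lemma subalgebra_add_derived U :
  is_subalgebra U -> (U + L2)%VS = fullv -> U = fullv.
Proof.
move=> subU fullU; have [K LK0] := nilL.
suff lcU k : (U + lower_central L k.+1)%VS = fullv.
  apply/eqP; rewrite eqEsubv subvf -(lcU K) subv_add subvv.
  by rewrite (subv_trans (lower_centralS K)) // LK0 sub0v.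
elim: k => [|k IHk] //; apply/eqP; rewrite eqEsubv subvf -fullU subv_add addvSl.
apply/bracket_spaceP=> x y _ _; have := memvf x; have := memvf y.
rewrite -IHk => /memv_addP[u Uu [v Lv ->]] /memv_addP[u' Uu' [v' Lv' ->]].
rewrite bracketDl (bracketC v') bracketDr -addrA memv_add //; first exact: subU.
rewrite rpredB //; exact: mem_lower_centralS.
Qed.

(** The last nonzero term of the lower central series is central, and it lies
    in $L^2$ since $L^2 \neq 0$. *)
Lemma center_derived_neq0 : L2 != 0%VS -> (L2 :&: Z)%VS != 0%VS.
Proof.
move=> L2n0; have [K LK0] := nilL.
suff IH k : lower_central L k.+1 = 0%VS -> (L2 :&: Z)%VS != 0%VS.
  by apply: (IH K); apply/eqP; rewrite -subv0 -LK0 lower_centralS.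
elim: k => [|k IHk] lck0; first by rewrite -[L2]/(lower_central L 1) lck0 eqxx in L2n0.
have [lcz | lcn0] := eqVneq (lower_central L k.+1) 0%VS; first exact: IHk.
apply: contraNneq lcn0 => cap0; rewrite -subv0 -cap0 subv_cap; apply/andP; split.
  elim: k {lck0 IHk} => [|k IHk]; first exact: subvv.
  by apply: subv_trans IHk; apply: lower_centralS.
apply/subvP=> x Lx; apply/center_spaceP=> y; rewrite bracketC.
have := mem_lower_centralS y Lx; rewrite lck0.
by rewrite memv0 => /eqP->; rewrite oppr0.
Qed.

End NilpotentTheory.

Section Generators.
Variables (F : fieldType) (L : lieAlgType F) (nilL : nilpotent_lie L).

(** By [subalgebra_add_derived] a family generates $L$ as soon as its
    linear span supplements $[L,L]$; conversely the span of a generating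
    family plus $[L,L]$ is a subalgebra. *)
Lemma min_num_generatorsE d :
  is_min_num_generators L d -> d = (\dim {:L} - \dim (derived_alg L))%N.
Proof.
case=> -[A [_ genA <-]] minA; apply/eqP; rewrite eqn_leq; apply/andP; split.
  rewrite -dimv_compl -(size_tuple (vbasis (derived_alg L)^C)).
  apply: minA; first exact: free_uniq (basis_free (vbasisP _)).
  move=> U subU XU; apply: (subalgebra_add_derived nilL subU).
  apply/eqP; rewrite eqEsubv subvf -(addv_complf (derived_alg L)) subv_add addvSr /=.
  apply: subv_trans (addvSl _ _); rewrite -(span_basis (vbasisP (derived_alg L)^C)).
  exact/span_subvP.
rewrite leq_subLR -(genA (<<A>> + derived_alg L)%VS) => [||a Aa].
- rewrite addnC (leq_trans (dimv_add_leqif _ _)) // leq_add2r.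
  exact: dim_span.
- by move=> u v _ _; rewrite (subvP (addvSr _ _)) ?mem_derived.
- by rewrite (subvP (addvSl _ _)) ?memv_span.
Qed.

End Generators.

(** * The quotient by the center and the invariant t *)

Section CentralQuotient.
Variables (F : fieldType) (L : lieAlgType F).
Local Notation Z := (center_space L).
Local Notation Q := (lie_quot (lie_center L)).
Local Notation pi := (\pi_Q%qT : L -> Q).

HB.instance Definition _ :=
  GRing.isLinear.Build F L Q _ pi (@pi_quot_linear F L (lie_center L)).

Lemma dim_pi_quot (U : {vspace L}) :
  (\dim (U :&: Z) + \dim (linfun pi @: U))%N = \dim U.
Proof.
rewrite -(limg_ker_dim (linfun pi) U); congr (\dim (_ :&: _) + _)%N.
apply/vspaceP=> x; rewrite memv_ker lfunE /=; apply/idP/eqP => [Zx | pix0].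
  rewrite -(linear0 pi); apply/(@quot_eqP F L (lie_center L)).
  by rewrite subr0.
rewrite -[x]subr0; apply/(@quot_eqP F L (lie_center L)).
by rewrite [LHS]pix0 [RHS]linear0.
Qed.

Lemma limg_pi_quot : limg (linfun pi) = fullv.
Proof.
apply/eqP; rewrite eqEsubv subvf; apply/subvP=> u _.
by apply/linear_fun_limg; exists (repr u); rewrite ?memvf //= reprK.
Qed.

Lemma dim_center_quot : \dim {:Q} = (\dim {:L} - \dim Z)%N.
Proof. by rewrite -(dim_pi_quot fullv) limg_pi_quot capfv addKn. Qed.

Lemma limg_pi_bracket (U V : {vspace L}) :
  (linfun pi @: bracket_space U V)%VS
    = bracket_space (linfun pi @: U) (linfun pi @: V).
Proof.
apply/eqP; rewrite eqEsubv; apply/andP; split; last first.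
  apply/bracket_spaceP=> _ _ /linear_fun_limg[u Uu ->] /linear_fun_limg[v Vv ->].
  apply/linear_fun_limg; exists \[u, v]; first exact: mem_bracket_space.
  by rewrite [RHS](pi_quot_bracket (lie_center L)).
set W := bracket_space _ (_ @: V); suff: (bracket_space U V <= linfun pi @^-1: W)%VS.
  move=> /subvP sUV; apply/subvP=> _ /memv_imgP[w /sUV Ww ->].
  by rewrite memv_preim.
apply/bracket_spaceP=> u v Uu Vv; rewrite -memv_preim lfunE /=.
rewrite (pi_quot_bracket (lie_center L)).
by apply: mem_bracket_space; apply/linear_fun_limg; [exists u | exists v].
Qed.

Lemma nilpotent_center_quot : nilpotent_lie L -> nilpotent_lie Q.
Proof.
case=> k LK0; exists k.
suff ->: lower_central Q k = (linfun pi @: lower_central L k)%VS.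
  by rewrite LK0 limg_line linear0.
elim: k {LK0} => [|k IHk] /=; first by rewrite limg_pi_quot.
by rewrite limg_pi_bracket IHk limg_pi_quot.
Qed.

(** The derived algebra of $L/Z$ is the image of $L^2$, which has dimension
    $\dim (L^2 + Z) - \dim Z$. *)
Lemma min_generators_center_quot d :
    nilpotent_lie L -> is_min_num_generators Q d ->
  d = (\dim {:L} - \dim (derived_alg L + Z))%N.
Proof.
move=> nilL /(min_num_generatorsE (nilpotent_center_quot nilL)) ->.
rewrite dim_center_quot; set LQ2 := derived_alg Q.
have ->: LQ2 = (linfun pi @: derived_alg L)%VS.
  by rewrite limg_pi_bracket limg_pi_quot.
rewrite -subnDA; congr (_ - _)%N; apply/eqP.
rewrite -(eqn_add2r (\dim (derived_alg L :&: Z))) dimv_sum_cap.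
by rewrite -addnA [X in (_ + X)%N]addnC dim_pi_quot addnC.
Qed.

End CentralQuotient.
Section Invariant.
Variables (F : fieldType) (L : lieAlgType F).
Local Notation Z := (center_space L).
Local Notation L2 := (derived_alg L).

(** The invariant $t(L)$, with the number of generators of $L/Z(L)$ replaced by
    the codimension of $L^2 + Z(L)$; it makes sense for every Lie algebra. *)
Definition t_formula : int :=
  (\dim {:L} - \dim (L2 + Z))%N%:Z * (\dim L2)%:Z - (\dim {:L} - \dim Z)%N%:Z.

Lemma t_invariantE d :
    nilpotent_lie L -> is_min_num_generators (lie_quot (lie_center L)) d ->
  t_invariant L d = t_formula.
Proof.
move=> nilL genQ; rewrite /t_invariant dim_center_quot.
by rewrite (min_generators_center_quot nilL genQ).
Qed.

End Invariant.

(** * Direct sums with a central summand *)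

Section LinearCombination.
Variables (F : fieldType) (V : vectType F) (n : nat) (X : seq V).

Definition lincomb (u : 'rV[F]_n) : V := \sum_(i < n) u 0 i *: X`_i.

Fact lincomb_linear : linear lincomb.
Proof.
move=> a u v; rewrite /lincomb scaler_sumr -big_split; apply: eq_bigr => i _ /=.
by rewrite !mxE scalerA -scalerDl.
Qed.
HB.instance Definition _ := GRing.isLinear.Build F 'rV[F]_n V _ lincomb lincomb_linear.

Lemma limg_lincomb : size X = n -> limg (linfun lincomb) = <<X>>%VS.
Proof.
move=> sizeX; apply/vspaceP=> x; apply/linear_fun_limg/idP => [[u _ ->] | ].
  by rewrite memv_suml // => i _; rewrite memvZ ?memv_span ?mem_nth ?sizeX.
have/eqP sizeXt := sizeX; rewrite -[X]/(tval (Tuple sizeXt)) => /coord_span->.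
exists (\row_i coord (Tuple sizeXt) i x); rewrite ?memvf //.
by apply: eq_bigr => i _; rewrite mxE.
Qed.

Lemma lincomb_eq0 u : size X = n -> free X -> lincomb u = 0 -> u = 0.
Proof.
move=> /eqP sizeX freeX; have: free (Tuple sizeX) by [].
move=> /freeP free0 /(free0 (u 0)) u0; apply/rowP=> i.
by rewrite u0 mxE.
Qed.

End LinearCombination.

Section LieIsomorphism.
Variable F : fieldType.
Implicit Types L M : lieAlgType F.

Lemma linear_bij (V W : vectType F) (f : {linear V -> W}) :
  injective f -> limg (linfun f) = fullv -> bijective f.
Proof.
move=> injf fullf; exists (linfun f)^-1%VF => [v | w].
  rewrite -[f v](lfunE f) lker0_lfunK //; apply/lker0P=> x y.
  by rewrite !lfunE => /injf.
by rewrite -[LHS](lfunE f) limg_lfunVK // fullf memvf.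
Qed.

Lemma linear_inverse (V W : vectType F) (f : {linear V -> W}) :
  bijective f -> exists g : {linear W -> V}, cancel f g /\ cancel g f.
Proof.
case=> g fK gK; have lin_g : linear g by apply: can2_linear gK.
pose G := HB.pack_for {linear W -> V} g (GRing.isLinear.Build F W V *:%R g lin_g).
by exists G.
Qed.

Lemma lie_isog_sym L M : lie_isog L M -> lie_isog M L.
Proof.
case=> f [bijf morphf]; have [g [fK gK]] := linear_inverse bijf.
exists g; split; first by exists f.
by move=> x y; apply: (can_inj fK); rewrite morphf !gK.
Qed.

End LieIsomorphism.

Section SplitAbelian.
Variables (F : fieldType) (L M : lieAlgType F) (p : nat).
Local Notation A := (abelian_lie F p).
Local Notation Z := (center_space L).

(** An internal version of an isomorphism between $L$ and $M \oplus A$: the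
    image of $M$ is a direct summand with a central complement $C$. *)
Definition central_split (g : {linear M -> L}) (C : {vspace L}) : Prop :=
  [/\ injective g, {morph g : x y / \[x, y]}, (C <= Z)%VS,
      (limg (linfun g) + C)%VS = fullv & (limg (linfun g) :&: C)%VS = 0%VS].

(** When the dimensions add up, a generating pair is automatically direct and
    $g$ automatically injective. *)
Lemma central_split_dim (g : {linear M -> L}) (C : {vspace L}) :
    {morph g : x y / \[x, y]} -> (C <= Z)%VS ->
    (limg (linfun g) + C)%VS = fullv -> \dim {:L} = (\dim {:M} + \dim C)%N ->
  central_split g C.
Proof.
move=> morphg CZ full_gC dimL.
have dim_g := limg_ker_dim (linfun g) fullv.
have dim_gC := dimv_sum_cap (limg (linfun g)) C.
have [ker0 cap0] : \dim (lker (linfun g)) = 0%N /\ \dim (limg (linfun g) :&: C)%VS = 0%N.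
  move: dim_g dim_gC; rewrite full_gC capfv dimL.
  move: (\dim (lker _)) (\dim (limg _)) (\dim (_ :&: _)) => k i c <-.
  rewrite [(k + i)%N]addnC -!addnA => /eqP; rewrite eqn_add2l addnCA -[X in _ == X]addn0.
  by rewrite eqn_add2l addn_eq0 => /andP[/eqP-> /eqP->].
split=> //; last by apply/eqP; rewrite -dimv_eq0 cap0.
have/lker0P injg : lker (linfun g) == 0%VS by rewrite -dimv_eq0 ker0.
by move=> x y eqg; apply: injg; rewrite !lfunE.
Qed.

(** Any linear bijection of $C$ with the abelian algebra of the same dimension
    extends $g$ to an isomorphism, because $C$ is central. *)
Lemma central_split_isog g C :
  central_split g C -> \dim C = p -> lie_isog L (M * A)%type.
Proof.
case=> injg morphg CZ full_gC cap_gC dimC; apply: lie_isog_sym.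
pose X : seq L := vbasis C.
have sizeX : size X = p by rewrite size_tuple.
have spanX : limg (linfun (@lincomb F L p X)) = C.
  by rewrite limg_lincomb // (span_basis (vbasisP C)).
have mem_X v : lincomb X (v : 'rV_p) \in C.
  by rewrite -spanX; apply/linear_fun_limg; exists v; rewrite ?memvf.
pose h (w : (M * A)%type) := g w.1 + lincomb X (w.2 : 'rV_p).
have lin_h : linear h.
  move=> a u v; rewrite /h /= !linearP scalerDr -!addrA; congr (_ + _).
  by rewrite addrCA.
pose H := HB.pack_for {linear (M * A)%type -> L} h
            (GRing.isLinear.Build F (M * A)%type L *:%R h lin_h).
have inj_h : injective h.
  apply/(raddf_inj (f := H)) => -[u v] /eqP; rewrite /= /h /= addr_eq0 => /eqP gu.
  have gu0: g u = 0.
    apply/eqP; rewrite -memv0 -cap_gC memv_cap {2}gu rpredN mem_X andbT.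
    by apply/linear_fun_limg; exists u; rewrite ?memvf.
  have v0 : v = 0.
    apply: (@lincomb_eq0 _ _ _ X) => //; first exact: basis_free (vbasisP C).
    by apply/eqP; rewrite -oppr_eq0 -gu gu0.
  by rewrite v0; congr pair; apply: injg; rewrite gu0 linear0.
exists H; split.
  apply: (linear_bij (f := H)) => //; apply/eqP; rewrite eqEsubv subvf.
  apply/subvP=> x _; have := memvf x.
  rewrite -full_gC => /memv_addP[y /linear_fun_limg[u _ ->] [c]].
  rewrite -spanX => /linear_fun_limg[v _ ->] ->.
  by apply/linear_fun_limg; exists (u, v); rewrite ?memvf.
move=> [u v] [u' v']; rewrite /= /h /= morphg linear0 addr0.
have XZ (w : A) := subvP CZ _ (mem_X w).
by rewrite bracketDl !bracketDr !(bracket_central _ (XZ _)) (central_bracket _ (XZ _)) !addr0.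
Qed.

Lemma isog_central_split :
  lie_isog L (M * A)%type -> exists (g : {linear M -> L}) C, central_split g C.
Proof.
case=> f [bijf morphf]; have [h [fK hK]] := linear_inverse bijf.
have morphh x y : h \[x, y] = \[h x, h y].
  by apply: (can_inj fK); rewrite morphf !hK.
pose g u := h (u, 0); pose k (v : A) := h (0, v).
have lin_g : linear g.
  move=> a u v; rewrite /g -linearP; congr (h (_, _)).
  by rewrite /= scaler0 addr0.
have lin_k : linear k.
  move=> a u v; rewrite /k -linearP; congr (h (_, _)).
  by rewrite /= scaler0 addr0.
pose G := HB.pack_for {linear M -> L} g (GRing.isLinear.Build F M L *:%R g lin_g).
pose K := HB.pack_for {linear A -> L} k (GRing.isLinear.Build F A L *:%R k lin_k).
exists G, (limg (linfun K)); split.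
- by move=> u v /(can_inj hK) [].
- move=> u v /=; rewrite /g -morphh; congr (h (_, _)).
- apply/subvP=> _ /linear_fun_limg[v _ ->]; apply/center_spaceP=> x.
  rewrite -[x]fK -morphh; case: (f x) => u w.
  rewrite -[RHS](linear0 h); congr (h (_, _)); exact: bracket0r.
- apply/eqP; rewrite eqEsubv subvf; apply/subvP=> x _.
  rewrite -[x]fK; case: (f x) => u v.
  have ->: (u, v) = (u, 0) + (0, v) :> (M * A)%type.
    by congr pair; rewrite /= ?addr0 ?add0r.
  rewrite linearD memv_add //; apply/linear_fun_limg.
    by exists u; rewrite ?memvf.
  by exists v; rewrite ?memvf.
- apply/eqP; rewrite -subv0; apply/subvP=> x /memv_capP[].
  move=> /linear_fun_limg[u _ ->] /linear_fun_limg[v _] /(can_inj hK) [-> _].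
  by rewrite memv0; apply/eqP; apply: linear0.
Qed.

(** Write $L = g(M) \oplus C$ with $C$ central: then $L^2 = g(M^2)$ and
    $Z(L) = g(Z(M)) \oplus C$, so that the codimensions of $Z$ and of
    $L^2 + Z$, as well as $\dim L^2$, do not see $C$. *)
Lemma t_formula_split : lie_isog L (M * A)%type -> t_formula L = t_formula M.
Proof.
case/isog_central_split=> g [C [injg morphg CZ full_gC cap_gC]].
have capU (U : {vspace M}) : (linfun g @: U :&: C)%VS = 0%VS.
  by apply/eqP; rewrite -subv0 -cap_gC capvS ?limgS ?subvf.
have dimU (U : {vspace M}) : \dim (linfun g @: U + C) = (\dim U + \dim C)%N.
  by rewrite dimv_disjoint_sum // dim_limg_inj.
have dimL : \dim {:L} = (\dim {:M} + \dim C)%N by rewrite -full_gC dimU.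
have derL : derived_alg L = (linfun g @: derived_alg M)%VS.
  apply/eqP; rewrite eqEsubv; apply/andP; split.
    apply/bracket_spaceP=> x y _ _; have := memvf x; have := memvf y.
    rewrite -full_gC => /memv_addP[_ /linear_fun_limg[v _ ->] [c' Cc' ->]].
    move=> /memv_addP[_ /linear_fun_limg[u _ ->] [c Cc ->]].
    have [Zc Zc'] := (subvP CZ _ Cc, subvP CZ _ Cc').
    rewrite bracketDl !bracketDr !(bracket_central _ Zc') (central_bracket _ Zc) !addr0.
    by rewrite -morphg; apply/linear_fun_limg; exists \[u, v]; rewrite ?mem_derived.
  suff: (derived_alg M <= linfun g @^-1: derived_alg L)%VS.
    by move=> /subvP sM; apply/subvP=> _ /memv_imgP[u /sM Mu ->]; rewrite memv_preim.
  by apply/bracket_spaceP=> u v _ _; rewrite -memv_preim lfunE /= morphg mem_derived.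
have cenL : Z = (linfun g @: center_space M + C)%VS.
  apply/eqP; rewrite eqEsubv subv_add CZ andbT; apply/andP; split.
    apply/subvP=> z Zz; have := memvf z; rewrite -full_gC.
    move=> /memv_addP[_ /linear_fun_limg[u _ ->] [c Cc zE]].
    rewrite zE memv_add //; apply/linear_fun_limg; exists u => //.
    apply/center_spaceP=> v; apply: injg; rewrite linear0 morphg.
    rewrite -[g u](addrK c) -zE bracketBl.
    by rewrite (central_bracket _ Zz) (central_bracket _ (subvP CZ _ Cc)) subr0.
  apply/subvP=> _ /linear_fun_limg[u Zu ->]; apply/center_spaceP=> x.
  have := memvf x; rewrite -full_gC => /memv_addP[_ /linear_fun_limg[v _ ->] [c Cc ->]].
  by rewrite bracketDr -morphg central_bracket // linear0 add0r bracket_central ?(subvP CZ).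
rewrite /t_formula derL cenL addvA -limgD !dimU dimL !subnDr.
by rewrite dim_limg_inj.
Qed.

End SplitAbelian.
(** * Lie algebras given by a structure table *)

Section StructureTables.
Variables (F : fieldType) (n : nat).
Implicit Types (u v : 'rV[F]_n.+1) (s : seq (nat * nat * nat)) (C D : seq nat).

Definition is_index (k : nat) := (0 < k <= n.+1)%N.

(** Every bracket is recorded in the increasing order of its arguments. *)
Definition table_wf s :=
  all (fun t => [&& is_index t.1.1, is_index t.1.2, is_index t.2
                  & t.1.1 < t.1.2]%N) s.

Definition coord_space (C : seq nat) : {vspace 'rV[F]_n.+1} :=
  <<[seq basis_vec F n k | k <- C]>>%VS.

Lemma coef_basis_vec k l :
  is_index k -> is_index l -> coef (basis_vec F n k) l = (l == k)%:R.
Proof.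
case: k l => [|k] [|l] //= k_lt l_lt; rewrite /coef /basis_vec mxE eqxx /=.
by rewrite -val_eqE /= !inordK.
Qed.

Definition coord_form (k : nat) u : F^o := coef u k.
Fact coord_form_linear k : linear (coord_form k).
Proof. by move=> a u v; apply: coefP. Qed.
HB.instance Definition _ k :=
  GRing.isLinear.Build F 'rV[F]_n.+1 F^o _ (coord_form k) (coord_form_linear k).

Lemma coef_ord u (i : 'I_n.+1) : coef u i.+1 = u 0 i.
Proof. by rewrite /coef inord_val. Qed.

Lemma coef_table_bracket s u v l :
  coef (table_bracket s u v) l
    = \sum_(t <- s) (coef u t.1.1 * coef v t.1.2 - coef u t.1.2 * coef v t.1.1)
                      * coef (basis_vec F n t.2) l.
Proof.
rewrite /table_bracket /coef summxE; apply: eq_bigr => t _.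
by rewrite !mxE.
Qed.

Lemma row_sum_basis_vec u : u = \sum_(i < n.+1) coef u i.+1 *: basis_vec F n i.+1.
Proof.
rewrite {1}[u]row_sum_delta; apply: eq_bigr => i _.
by rewrite coef_ord /basis_vec inord_val.
Qed.

Lemma coord_spaceP C u :
    all is_index C ->
  reflect (forall k, is_index k -> k \notin C -> coef u k = 0) (u \in coord_space C).
Proof.
move=> idxC; apply: (iffP idP) => [Cu k idxk Ck | u0].
  have: (coord_space C <= lker (linfun (coord_form k)))%VS.
    apply/span_subvP=> _ /mapP[l Cl ->]; rewrite memv_ker lfunE.
    rewrite /= /coord_form coef_basis_vec ?(allP idxC _ Cl) // [k == l]eq_sym.
    by rewrite (negPf (memPn Ck l Cl)) eqxx.
  by move/subvP=> /(_ u Cu); rewrite memv_ker lfunE => /eqP.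
rewrite [u]row_sum_basis_vec memv_suml // => i _.
have [Ci | C'i] := boolP (i.+1 \in C); first by rewrite memvZ ?memv_span ?map_f.
by rewrite u0 ?scale0r ?mem0v // /is_index /= ltnS -ltnS ltn_ord.
Qed.

Lemma basis_vec_free C : all is_index C -> uniq C -> free [seq basis_vec F n k | k <- C].
Proof.
elim: C => [|k C IHC] /=; first by rewrite nil_free.
case/andP=> idxk idxC /andP[C'k uniqC]; rewrite free_cons IHC // andbT.
apply/negP=> /(coord_spaceP _ idxC)/(_ k idxk C'k)/eqP.
by rewrite coef_basis_vec // eqxx oner_eq0.
Qed.

Lemma dim_coord_space C :
  all is_index C -> uniq C -> \dim (coord_space C) = size C.
Proof. by move=> idxC uniqC; rewrite (eqnP (basis_vec_free idxC uniqC)) size_map. Qed.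

End StructureTables.
Section TableLie.
Variables (F : fieldType) (n : nat) (s : seq (nat * nat * nat)).
Hypothesis wf_s : table_wf n s.
Hypothesis jac : table_jacobi F n s.
Local Notation e := (basis_vec F n).
Local Notation br := (@table_bracket F n s).

(** The Heisenberg algebra and the four algebras of dimension 4 and 5 are
    convertible to instances of this construction. *)
Definition table_lie : lieAlgType F :=
  HB.pack 'rV[F]_n.+1
    (isLieAlgebra.Build F 'rV[F]_n.+1 (@table_bracket_linearl F n s)
       (@table_bracket_linearr F n s) (@table_bracketxx F n s) jac).

Lemma table_entry_index t : t \in s ->
  [/\ is_index n t.1.1, is_index n t.1.2, is_index n t.2 & (t.1.1 < t.1.2)%N].
Proof. by move=> /(allP wf_s) /and4P. Qed.

Lemma derived_table D :
    {in s, forall t, t.2 \in D} -> {in D, forall k, exists u v, br u v = e k} ->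
  derived_alg table_lie = coord_space F n D.
Proof.
move=> sD Ds; apply/eqP; rewrite eqEsubv; apply/andP; split.
  apply/bracket_spaceP=> u v _ _; rewrite -[\[u, v]]/(br u v) /table_bracket.
  by rewrite big_seq memv_suml // => t /sD Dt; rewrite memvZ ?memv_span ?map_f.
apply/span_subvP=> _ /mapP[k /Ds[u [v <-]] ->].
exact: (@mem_derived F table_lie u v).
Qed.

Lemma center_table C :
    all (is_index n) C ->
    {in s, forall t, t.1.1 \notin C /\ t.1.2 \notin C} ->
    (forall u, (forall v, br u v = 0) ->
      forall k, is_index n k -> k \notin C -> coef u k = 0) ->
  center_space table_lie = coord_space F n C.
Proof.
move=> idxC sC cenC; apply/vspaceP=> u; apply/center_spaceP/(coord_spaceP _ idxC).
  by move=> Zu; apply: cenC => v; apply: Zu.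
move=> u0 v; rewrite -[\[u, v]]/(br u v) /table_bracket big1_seq // => t /= st.
have [idx1 idx2 _ _] := table_entry_index st; have [C1 C2] := sC t st.
by rewrite !u0 // !mul0r subrr scale0r.
Qed.

(** The sets D and C number the basis vectors that span the derived algebra and
    the center. *)
Lemma t_formula_table (D C : seq nat) :
    all (is_index n) D -> uniq D -> uniq C -> {subset C <= D} ->
    {in s, forall t, [&& t.1.1 \notin C, t.1.2 \notin C & t.2 \in D]} ->
    {in D, forall k, exists u v, br u v = e k} ->
    (forall u, (forall v, br u v = 0) ->
      forall k, is_index n k -> k \notin C -> coef u k = 0) ->
  t_formula table_lie
    = (n.+1 - size D)%N%:Z * (size D)%:Z - (n.+1 - size C)%N%:Z.
Proof.
move=> idxD uniqD uniqC CD sDC Ds cenC.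
have idxC : all (is_index n) C by apply/allP=> k /CD; apply: (allP idxD).
have dimM : \dim {:table_lie} = n.+1 by rewrite dimvf /dim /= mul1n.
have derM : derived_alg table_lie = coord_space F n D.
  by apply: derived_table => // t /sDC /and3P[].
have cenM : center_space table_lie = coord_space F n C.
  by apply: center_table => // t /sDC /and3P[].
have sCD : (coord_space F n C <= coord_space F n D)%VS.
  by apply: sub_span => _ /mapP[k Ck ->]; rewrite map_f ?CD.
have DC : (derived_alg table_lie + center_space table_lie)%VS = coord_space F n D.
  by rewrite derM cenM; apply/addv_idPl.
have dimD : \dim (derived_alg table_lie) = size D by rewrite derM dim_coord_space.
have dimC : \dim (center_space table_lie) = size C by rewrite cenM dim_coord_space.
by rewrite /t_formula DC -derM dimD dimC dimM.
Qed.

Section Morphism.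
Variables (L : lieAlgType F) (X : seq L).
Local Notation x k := (X`_k.-1).

Lemma lincomb_basis_vec k : is_index n k -> lincomb X (e k) = x k.
Proof.
case: k => // k /= lekn; rewrite /lincomb (bigD1 (Ordinal lekn)) //= big1 => [|i neqi].
  by rewrite addr0 /basis_vec mxE eqxx -val_eqE /= inordK ?eqxx ?scale1r.
rewrite /basis_vec mxE eqxx -val_eqE /= inordK //.
by rewrite -val_eqE /= in neqi; rewrite (negPf neqi) scale0r.
Qed.

Lemma sum_index_pair (u v : 'rV[F]_n.+1) p q : is_index n p -> is_index n q ->
  \sum_(i < n.+1) \sum_(j < n.+1) u 0 i * v 0 j * ((p, q) == (i.+1, j.+1))%:R
    = coef u p * coef v q.
Proof.
case: p q => // p [|q] // ltp ltq; pose i := Ordinal ltp; pose j := Ordinal ltq.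
rewrite (bigD1 i) //= (bigD1 j) //= eqxx mulr1 !big1 ?addr0 => [|k neqk|k neqk].
- by rewrite -[p]/(val i) -[q]/(val j) !coef_ord.
- apply: big1 => l _; rewrite xpair_eqE eqSS [_ == _ :> nat]eq_sym.
  by rewrite -[p]/(val i) val_eqE (negPf neqk) mulr0.
- rewrite xpair_eqE !eqSS [X in _ && X]eq_sym.
  by rewrite -[q]/(val j) val_eqE (negPf neqk) andbF mulr0.
Qed.

(** By bilinearity and antisymmetry it is enough to check the brackets
    $[x_i, x_j]$ with $i < j$. *)
Lemma lincomb_table_morph :
    (forall i j, (0 < i)%N -> (i < j)%N -> (j <= n.+1)%N ->
       \[x i, x j] = \sum_(t <- s | t.1 == (i, j)) x t.2) ->
  {morph (lincomb X : table_lie -> L) : u v / \[u, v]}.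
Proof.
move=> Xs u v; pose c (t : nat * nat * nat) (i j : nat) : F :=
  (t.1 == (i, j))%:R - (t.1 == (j, i))%:R.
have XE i j : (0 < i <= n.+1)%N -> (0 < j <= n.+1)%N ->
    \[x i, x j] = \sum_(t <- s) c t i j *: x t.2.
  move=> /andP[i0 lei] /andP[j0 lej].
  have half p q : (0 < p)%N -> (p < q)%N -> (q <= n.+1)%N ->
      \[x p, x q] = \sum_(t <- s) c t p q *: x t.2.
    move=> p0 ltpq leq; rewrite Xs // big_mkcond /= big_seq [RHS]big_seq.
    apply: eq_bigr => t st; have [_ _ _ lt12] := table_entry_index st.
    have /negPf n21 : t.1 != (q, p).
      by apply: contraTneq lt12 => -> /=; rewrite -leqNgt ltnW.
    by rewrite /c n21 subr0; case: eqP => _; rewrite ?scale1r ?scale0r.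
  have [ltij | ltji | <-] := ltngtP i j; first exact: half.
    rewrite bracketC half // -sumrN; apply: eq_bigr => t _.
    by rewrite -scaleNr /c opprB.
  by rewrite bracketxx big1 // => t _; rewrite /c subrr scale0r.
rewrite -[\[u, v]]/(br u v) /table_bracket linear_sum.
rewrite /lincomb bracket_suml.
transitivity (\sum_(i < n.+1) \sum_(j < n.+1) \sum_(t <- s)
    (u 0 i * v 0 j * c t i.+1 j.+1) *: x t.2); last first.
  apply: eq_bigr => i _; rewrite bracketZl bracket_sumr scaler_sumr.
  apply: eq_bigr => j _; rewrite bracketZr scalerA.
  rewrite (XE i.+1 j.+1) ?ltn_ord // scaler_sumr.
  by apply: eq_bigr => t _; rewrite scalerA.
under [RHS]eq_bigr => i _ do rewrite exchange_big /=.
rewrite [RHS]exchange_big /= big_seq [RHS]big_seq; apply: eq_bigr => t st.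
have [idx1 idx2 idx3 _] := table_entry_index st.
rewrite linearZ /= -/(lincomb X (e t.2)) lincomb_basis_vec //.
under [RHS]eq_bigr => i _ do rewrite -scaler_suml.
rewrite -scaler_suml; congr (_ *: _).
rewrite -(sum_index_pair u v idx1 idx2) -(sum_index_pair u v idx2 idx1).
rewrite -sumrB; apply: eq_bigr => i _; rewrite -sumrB; apply: eq_bigr => j _.
rewrite -mulrBr; congr (_ * _); rewrite /c; case: (t.1) => a b.
by rewrite !xpair_eqE [(b == _) && _]andbC.
Qed.
End Morphism.

End TableLie.
(** * The value of t on the algebras of the classification *)

Section TableInvariants.
Variable F : fieldType.

Local Ltac simpl_scale :=
  rewrite ?(mulr0, mulr1, mul0r, mul1r, subr0, sub0r, oppr0, scale0r, scale1r, addr0, add0r).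

Local Ltac table_generator i j :=
  exists (basis_vec F _ i), (basis_vec F _ j);
  rewrite /table_bracket !big_cons big_nil /= !coef_basis_vec //= ; simpl_scale; reflexivity.

(** For central u, coordinate l of $[u, x_j] = 0$ is, up to sign, a single
    coordinate of u. *)
Local Ltac central_coef cenu j l :=
  move: (congr1 (fun w => coef w l) (cenu (basis_vec F _ j)));
  rewrite coef_table_bracket !big_cons big_nil /= !coef_basis_vec //=; simpl_scale;
  rewrite [coef 0 _]mxE => /eqP; rewrite ?oppr_eq0; move/eqP.

Lemma t_formula_L_4_3 : t_formula (L_4_3 F) = 1.
Proof.
rewrite -[L_4_3 F : lieAlgType F]/(table_lie (jacobi_4_3 (F:=F))).
rewrite (@t_formula_table _ _ table_4_3 _ _ [:: 3; 4]%N [:: 4]%N) //.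
- by apply/allP.
- by apply/allP.
- move=> k; rewrite !inE => /orP[] /eqP->; [table_generator 1%N 2%N | table_generator 1%N 3%N].
- move=> u cenu [|[|[|[|[|k]]]]] // _ _.
  + by central_coef cenu 2%N 3%N.
  + by central_coef cenu 1%N 3%N.
  + by central_coef cenu 1%N 4%N.
Qed.

Lemma t_formula_L_5_5 : t_formula (L_5_5 F) = 2.
Proof.
rewrite -[L_5_5 F : lieAlgType F]/(table_lie (jacobi_5_5 (F:=F))).
rewrite (@t_formula_table _ _ table_5_5 _ _ [:: 3; 5]%N [:: 5]%N) //.
- by apply/allP.
- by apply/allP.
- move=> k; rewrite !inE => /orP[] /eqP->; [table_generator 1%N 2%N | table_generator 1%N 3%N].
- move=> u cenu [|[|[|[|[|[|k]]]]]] // _ _.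
  + by central_coef cenu 2%N 3%N.
  + by central_coef cenu 1%N 3%N.
  + by central_coef cenu 1%N 5%N.
  + by central_coef cenu 2%N 5%N.
Qed.

Lemma t_formula_L_5_6 : t_formula (L_5_6 F) = 2.
Proof.
rewrite -[L_5_6 F : lieAlgType F]/(table_lie (jacobi_5_6 (F:=F))).
rewrite (@t_formula_table _ _ table_5_6 _ _ [:: 3; 4; 5]%N [:: 5]%N) //.
- by apply/allP.
- by apply/allP.
- move=> k; rewrite !inE => /or3P[] /eqP->.
  + table_generator 1%N 2%N.
  + table_generator 1%N 3%N.
  + table_generator 1%N 4%N.
- move=> u cenu [|[|[|[|[|[|k]]]]]] // _ _.
  + by central_coef cenu 2%N 3%N.
  + by central_coef cenu 1%N 3%N.
  + by central_coef cenu 1%N 4%N.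
  + by central_coef cenu 1%N 5%N.
Qed.

Lemma t_formula_L_5_7 : t_formula (L_5_7 F) = 2.
Proof.
rewrite -[L_5_7 F : lieAlgType F]/(table_lie (jacobi_5_7 (F:=F))).
rewrite (@t_formula_table _ _ table_5_7 _ _ [:: 3; 4; 5]%N [:: 5]%N) //.
- by apply/allP.
- by apply/allP.
- move=> k; rewrite !inE => /or3P[] /eqP->.
  + table_generator 1%N 2%N.
  + table_generator 1%N 3%N.
  + table_generator 1%N 4%N.
- move=> u cenu [|[|[|[|[|[|k]]]]]] // _ _.
  + by central_coef cenu 2%N 3%N.
  + by central_coef cenu 1%N 3%N.
  + by central_coef cenu 1%N 4%N.
  + by central_coef cenu 1%N 5%N.
Qed.

Section Heisenberg.
Variable m : nat.
Local Notation n := (2 * m)%N.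
Local Notation br := (@table_bracket F n (heisenberg_table m)).

Lemma heisenberg_table_wf : table_wf n (heisenberg_table m).
Proof.
apply/allP=> _ /mapP[i + ->] /=; rewrite mem_iota /is_index /=; lia.
Qed.

Lemma heisenberg_bracket_even (u : 'rV[F]_n.+1) a : (0 < a <= m)%N ->
  br u (basis_vec F n (2 * a)) = coef u (2 * a).-1 *: basis_vec F n n.+1.
Proof.
move=> a_m; rewrite /table_bracket big_map (bigD1_seq a) /=; last exact: iota_uniq.
  rewrite big1_seq => [|i /=]; last rewrite mem_iota => /andP[neqia im].
    rewrite addr0 !coef_basis_vec /is_index ?eqxx; try lia.
    by rewrite (_ : (_.-1 == _) = false) ?mulr0 ?mulr1 ?subr0 //; lia.
  rewrite !coef_basis_vec /is_index; try lia.
  rewrite (_ : (_.-1 == _) = false); last lia.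
  by rewrite (_ : (_ == _) = false) ?mulr0 ?subr0 ?scale0r //; lia.
by rewrite mem_iota; lia.
Qed.

Lemma heisenberg_bracket_odd (u : 'rV[F]_n.+1) a : (0 < a <= m)%N ->
  br u (basis_vec F n (2 * a).-1) = - coef u (2 * a) *: basis_vec F n n.+1.
Proof.
move=> a_m; rewrite /table_bracket big_map (bigD1_seq a) /=; last exact: iota_uniq.
  rewrite big1_seq => [|i /=]; last rewrite mem_iota => /andP[neqia im].
    rewrite addr0 !coef_basis_vec /is_index ?eqxx; try lia.
    by rewrite (_ : (_ == _.-1) = false) ?mulr0 ?mulr1 ?sub0r //; lia.
  rewrite !coef_basis_vec /is_index; try lia.
  rewrite (_ : (2 * i == _)%N = false); last lia.
  by rewrite (_ : (_ == _) = false) ?mulr0 ?subr0 ?scale0r //; lia.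
by rewrite mem_iota; lia.
Qed.

Lemma t_formula_heisenberg : (0 < m)%N -> t_formula (heisenberg F m) = 0.
Proof.
move=> m_gt0.
rewrite -[heisenberg F m : lieAlgType F]/(table_lie (@heisenberg_jacobi F m)).
rewrite (@t_formula_table _ _ (heisenberg_table m) _ _ [:: n.+1] [:: n.+1]) //.
- by rewrite /= mulr1 subrr.
- exact: heisenberg_table_wf.
- by rewrite /= /is_index leqnn.
- move=> t /mapP[i]; rewrite mem_iota => im -> /=; rewrite !inE eqxx andbT.
  by rewrite !neq_ltn; lia.
- move=> k; rewrite inE => /eqP->; exists (basis_vec F n 1), (basis_vec F n 2).
  rewrite (heisenberg_bracket_even _ (a := 1)) //.
  by rewrite -[(2 * 1).-1]/1%N coef_basis_vec ?eqxx ?scale1r //.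
- move=> u cenu k; rewrite /is_index inE => idxk neqk.
  have basis_neq0 : basis_vec F n n.+1 != 0.
    apply/eqP=> /(congr1 (fun w => coef w n.+1)) /eqP.
    rewrite coef_basis_vec ?eqxx /is_index ?leqnn //.
    by rewrite /coef mxE oner_eq0.
  have [a am kE] : exists2 a, (0 < a <= m)%N & k = (2 * a).-1 \/ k = (2 * a)%N.
    by exists k.+1./2; lia.
  apply/eqP; case: kE => ->.
    have /eqP := cenu (basis_vec F n (2 * a)).
    by rewrite heisenberg_bracket_even // scaler_eq0 (negPf basis_neq0) orbF.
  have /eqP := cenu (basis_vec F n (2 * a).-1).
  by rewrite heisenberg_bracket_odd // scaler_eq0 (negPf basis_neq0) orbF oppr_eq0.
Qed.

(** The form in which the table enters [lincomb_table_morph]: all its entries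
    point to the same central vector. *)
Lemma heisenberg_table_sum (V : zmodType) (z : V) i j :
    (0 < i)%N -> (i < j)%N -> (j <= n.+1)%N ->
  \sum_(t <- heisenberg_table m | t.1 == (i, j)) z
    = if odd i && (j == i.+1) then z else 0.
Proof.
move=> i0 ltij lejn; rewrite big_map /=.
case: ifP => [/andP[oddi /eqP jE] | not_pair].
  rewrite -big_filter (_ : filter _ _ = [:: i.+1./2]) ?big_seq1 //.
  rewrite -[RHS](filter_pred1_uniq (iota_uniq 1 m)); last first.
    by rewrite mem_iota; lia.
  by apply: eq_filter => a; rewrite xpair_eqE /=; lia.
rewrite big1_seq // => a /andP[]; rewrite xpair_eqE mem_iota => /andP[/eqP ia /eqP ja] am.
by case/negP: (negbT not_pair); lia.
Qed.

End Heisenberg.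

End TableInvariants.
(** * Isomorphisms from adapted bases: abelian and Heisenberg algebras *)

Section AbelianAlgebras.
Variables (F : fieldType) (L : lieAlgType F).

Lemma derived_eq0P : reflect (forall x y : L, \[x, y] = 0) (derived_alg L == 0%VS).
Proof.
apply: (iffP eqP) => [L2_0 x y | abL].
  by apply/eqP; rewrite -memv0 -L2_0 mem_derived.
by apply/eqP; rewrite -subv0; apply/bracket_spaceP=> x y _ _; rewrite abL mem0v.
Qed.

Lemma abelian_isog :
  derived_alg L = 0%VS -> lie_isog L (abelian_lie F (\dim {:L})).
Proof.
move/eqP/derived_eq0P=> abL; apply: lie_isog_sym.
have sizeB : size (vbasis {:L}) = \dim {:L} by rewrite size_tuple.
pose f : {linear abelian_lie F (\dim {:L}) -> L} := @lincomb F L (\dim {:L}) (vbasis {:L}).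
exists f; split; last by move=> u v; rewrite abL linear0.
apply: linear_bij.
  apply/raddf_inj => u; apply: lincomb_eq0 => //.
  exact: basis_free (vbasisP _).
by rewrite limg_lincomb // (span_basis (vbasisP _)).
Qed.

Lemma t_formula_abelian : derived_alg L = 0%VS -> t_formula L = 0.
Proof.
move=> L2_0; have Zfull : center_space L = fullv.
  apply/eqP; rewrite eqEsubv subvf; apply/subvP=> x _; apply/center_spaceP=> y.
  by have/derived_eq0P := introT eqP L2_0; apply.
by rewrite /t_formula L2_0 Zfull dimv0 mulr0 subnn subrr.
Qed.

End AbelianAlgebras.

Section StructureBasis.
Variables (F : fieldType) (L : lieAlgType F).
Local Notation Z := (center_space L).
Local Notation L2 := (derived_alg L).

(** The central complement of the table algebra is a complement of
    $L^2 \cap Z$ in $Z$; the last hypothesis makes the sum direct by a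
    dimension count. *)
Lemma table_basis_isog n s (wf_s : table_wf n s) (jac : table_jacobi F n s) (X : seq L) :
    size X = n.+1 ->
    (forall i j, (0 < i)%N -> (i < j)%N -> (j <= n.+1)%N ->
       \[X`_i.-1, X`_j.-1] = \sum_(t <- s | t.1 == (i, j)) X`_(t.2).-1) ->
    (L2 <= <<X>>)%VS -> (<<X>> + (L2 + Z))%VS = fullv ->
    (\dim {:L} + \dim (L2 :&: Z))%N = (n.+1 + \dim Z)%N ->
  (n.+1 <= \dim {:L})%N /\
  lie_isog L (table_lie jac * abelian_lie F (\dim {:L} - n.+1))%type.
Proof.
move=> sizeX brX L2X fullX dimL.
have dimZ := dimv_cap_compl Z L2; rewrite capvC in dimZ.
have dimLC : \dim {:L} = (n.+1 + \dim (Z :\: L2))%N.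
  apply/eqP; rewrite -(eqn_add2r (\dim (L2 :&: Z))) dimL -dimZ.
  by rewrite -addnA eqn_add2l addnC.
split; first by rewrite dimLC leq_addr.
pose g : {linear table_lie jac -> L} := @lincomb F L n.+1 X.
have dimM : \dim {:table_lie jac} = n.+1 by rewrite dimvf /dim /= mul1n.
apply: (@central_split_isog _ _ _ _ g (Z :\: L2)%VS); last by rewrite dimLC addKn.
apply: central_split_dim; rewrite ?dimM ?diffvSl //.
  exact: lincomb_table_morph.
rewrite limg_lincomb //; apply/eqP; rewrite eqEsubv subvf -fullX !subv_add.
rewrite addvSl (subv_trans L2X) ?addvSl //= -{1}(addv_diff_cap Z L2) subv_add addvSr.
by rewrite (subv_trans (capvSr _ _)) // (subv_trans L2X) ?addvSl.
Qed.

End StructureBasis.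

Section Heisenberg.
Variables (F : fieldType) (L : lieAlgType F).
Local Notation Z := (center_space L).
Local Notation L2 := (derived_alg L).

Lemma bracket_neq0 (U : {vspace L}) :
  bracket_space U U != 0%VS -> exists x y, [/\ x \in U, y \in U & \[x, y] != 0].
Proof.
move=> brU; set s := [seq \[u, v] | u <- vbasis U, v <- vbasis U].
have /allPn[_ /allpairsP[[u v] /= [Uu Uv ->]] uv0] : ~~ all (pred1 0) s.
  apply: contra brU => /allP s0; rewrite -subv0; apply/span_subvP=> w /s0 /eqP->.
  exact: mem0v.
by exists u, v; split=> //; apply: vbasis_mem.
Qed.

Lemma memv_ker_ad (x y : L) : (y \in lker (ad x)) = (\[x, y] == 0).
Proof. by rewrite memv_ker lfunE. Qed.

(** When all brackets lie on one line, the bracket is an alternating form: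
    a hyperbolic pair $x, y$ splits off, with the intersection of the kernels of
    ad x and ad y as its orthogonal complement, until only the radical R is
    left. The vectors are numbered from 0, so that each pair starts at an even
    index. *)
Lemma symplectic_basis (z : L) :
    z != 0 -> (forall x y : L, \[x, y] \in <[z]>%VS) ->
  forall U : {vspace L}, exists m (e : seq L) (R : {vspace L}),
  [/\ size e = (2 * m)%N, (<<e>> + R)%VS = U, \dim U = (2 * m + \dim R)%N,
      forall u, u \in R = (u \in U) && (U <= lker (ad u))%VS
    & forall i j, (i < j)%N -> (j < 2 * m)%N ->
        \[e`_i, e`_j] = if ~~ odd i && (j == i.+1) then z else 0].
Proof.
move=> z0 brz U; have [k] := ubnP (\dim U); elim: k => // k IHk in U *.
rewrite ltnS => dimUk.
have [brU0 | /bracket_neq0[x [y [Ux Uy xy0]]]] := eqVneq (bracket_space U U) 0%VS.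
  exists 0%N, [::], U; split=> //; first by rewrite span_nil add0v.
  move=> u; apply/idP/andP=> [Uu | [] //]; split=> //.
  apply/subvP=> v Uv; rewrite memv_ker_ad -memv0 -brU0.
  exact: mem_bracket_space.
have /vlineP[a xyE] := brz x y.
have a0 : a != 0 by apply: contraNneq xy0 => a0; rewrite xyE a0 scale0r.
move: (a^-1 *: y) (memvZ a^-1 Uy) (bracketZr a^-1 x y).
rewrite xyE scalerA mulVf // scale1r => {}y {}Uy {xyE xy0}xyE.
pose U' := (U :&: (lker (ad x) :&: lker (ad y)))%VS.
have U'P u : (u \in U') = [&& u \in U, \[x, u] == 0 & \[y, u] == 0].
  by rewrite !memv_cap !memv_ker_ad.
have lineZ b : (b *: z == 0) = (b == 0) by rewrite scaler_eq0 (negPf z0) orbF.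
have yxE : \[y, x] = - z by rewrite bracketC xyE.
have free_xy : free [:: x; y].
  rewrite free_cons seq1_free span_seq1; apply/andP; split; last first.
    by apply: contra_neqN z0 => /eqP y0; rewrite -xyE y0 bracketr0.
  by apply: contra_neqN z0 => /vlineP[b xE]; rewrite -xyE xE bracketZl bracketxx scaler0.
have capU' : (<<[:: x; y]>> :&: U')%VS = 0%VS.
  apply/eqP; rewrite -subv0; apply/subvP=> w /memv_capP[].
  rewrite span_cons span_seq1 => /memv_addP[_ /vlineP[b ->] [_ /vlineP[c ->] ->]].
  rewrite U'P !bracketDr !bracketZr !bracketxx xyE yxE !scaler0 add0r addr0.
  rewrite scalerN oppr_eq0 !lineZ => /and3P[_ /eqP-> /eqP->].
  by rewrite !scale0r addr0 mem0v.
have sumU' : (<<[:: x; y]>> + U')%VS = U.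
  apply/eqP; rewrite eqEsubv subv_add capvSl andbT; apply/andP; split.
    by apply/span_subvP=> w; rewrite !inE => /orP[] /eqP->.
  apply/subvP=> u Uu; have /vlineP[b xuE] := brz x u; have /vlineP[c yuE] := brz y u.
  rewrite -[u](subrK (b *: y - c *: x)) addrC memv_add //.
    by rewrite rpredB ?memvZ ?memv_span ?inE ?eqxx ?orbT.
  rewrite U'P rpredB ?rpredB ?memvZ //= !bracketBr !bracketZr !bracketxx xuE yuE xyE yxE.
  by rewrite !scaler0 scalerN !(subr0, sub0r) opprK !subrr eqxx.
have dimU : \dim U = (2 + \dim U')%N.
  by rewrite -{1}sumU' dimv_disjoint_sum // (eqnP free_xy).
have [|m [e [R [size_e spanU' dimU' RE bre]]]] := IHk U'.
  by rewrite dimU in dimUk; apply: leq_trans dimUk; rewrite add2n.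
have U'e i : (i < 2 * m)%N -> e`_i \in U'.
  by move=> lti; rewrite -spanU' (subvP (addvSl _ _)) ?memv_span ?mem_nth ?size_e.
exists m.+1, (x :: y :: e), R; split=> [||||[|[|i]] [|[|j]] //=].
- by rewrite /= size_e mulnS.
- by rewrite -sumU' -spanU' addvA -span_cat.
- by rewrite dimU dimU' mulnS addnA.
- move=> u; rewrite RE U'P.
  apply/andP/andP=> [[/and3P[Uu xu0 yu0] /subvP orthU'] | [Uu /subvP orthU]].
    split=> //; rewrite -sumU' subv_add; apply/andP; split; last exact/subvP.
    apply/span_subvP=> w; rewrite !inE memv_ker_ad bracketC oppr_eq0.
    by case/orP=> /eqP->.
  have orth w : w \in U -> \[w, u] == 0.
    by move=> Uw; rewrite bracketC oppr_eq0 -memv_ker_ad orthU.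
  rewrite Uu !orth //; split=> //; apply/subvP=> v; rewrite U'P => /andP[Uv _].
  exact: orthU.
- rewrite mulnS => _ ltj; have := U'e j ltj; rewrite U'P => /and3P[_ /eqP-> _].
  by [].
- by rewrite mulnS => _ ltj; have := U'e j ltj; rewrite U'P => /and3P[_ _ /eqP->].
- by rewrite mulnS !ltnS negbK => ltij ltj; rewrite bre.
Qed.

Lemma heisenberg_isog :
    \dim L2 = 1%N -> (L2 <= Z)%VS ->
  exists m, [/\ (1 <= m)%N, (2 * m + 1 <= \dim {:L})%N
    & lie_isog L (heisenberg F m * abelian_lie F (\dim {:L} - 2 * m - 1))%type].
Proof.
move=> dimL2 L2Z; have L2n0 : L2 != 0%VS by rewrite -dimv_eq0 dimL2.
have [x [y [_ _ xy0]]] := bracket_neq0 L2n0.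
have L2E := dim1_vline dimL2 (mem_derived x y) xy0.
set z := \[x, y] in xy0 L2E.
have brz u v : \[u, v] \in <[z]>%VS by rewrite -L2E mem_derived.
have [m [e [R [size_e spanL dimL RE bre]]]] := symplectic_basis xy0 brz fullv.
have RZ : R = Z.
  apply/vspaceP=> u; rewrite RE memvf; apply/idP/center_spaceP=> [/subvP ku v | Zu].
    by apply/eqP; rewrite -memv_ker_ad ku ?memvf.
  by apply/subvP=> v _; rewrite memv_ker_ad Zu.
rewrite RZ in spanL dimL.
have m_gt0 : (0 < m)%N.
  rewrite lt0n; apply: contraNneq xy0 => m0.
  have e_nil : e = [::] by apply/nilP; rewrite /nilp size_e m0.
  have Zx : x \in Z by move: (memvf x); rewrite -spanL e_nil span_nil add0v.
  by rewrite /z central_bracket.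
have Zz : z \in Z by apply: (subvP L2Z); apply: mem_derived.
pose X := rcons e z.
have [] := @table_basis_isog _ L _ _ (heisenberg_table_wf m) (@heisenberg_jacobi F m) X.
- by rewrite size_rcons size_e.
- move=> i j i0 ltij lej.
  have -> : \sum_(t <- heisenberg_table m | t.1 == (i, j)) X`_(t.2).-1
          = \sum_(t <- heisenberg_table m | t.1 == (i, j)) z.
    rewrite big_seq_cond [RHS]big_seq_cond; apply: eq_bigr => t /andP[/mapP[k _ ->] _].
    by rewrite /= nth_rcons size_e ltnn eqxx.
  rewrite heisenberg_table_sum // /X !nth_rcons size_e.
  case: i i0 ltij => // i _; case: j lej => // j lej ltij /=.
  rewrite !ltnS in ltij lej; have lti : (i < 2 * m)%N by apply: leq_trans lej.
  rewrite lti eqSS; case: ifP => ltj; first exact: bre.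
  have jE : j = (2 * m)%N by apply/eqP; rewrite eqn_leq lej leqNgt ltj.
  rewrite jE eqxx bracket_central //; case: ifP => // /andP[/= oddi /eqP iE].
  by move: oddi; rewrite -[odd i]negbK -[~~ odd i]/(odd i.+1) -iE oddM.
- rewrite L2E -memvE memv_span // mem_rcons inE eqxx //.
- apply/eqP; rewrite eqEsubv subvf -{1}spanL addvS ?addvSr //.
  by apply: sub_span => w ew; rewrite mem_rcons inE ew orbT.
- by rewrite (capv_idPl L2Z) dimL2 dimL addSn addn1.
move=> len isogL; exists m; split=> //; first by rewrite addn1.
by rewrite -subnDA addn1.
Qed.

End Heisenberg.
(** * Generators modulo the derived algebra *)

Section GeneratorsModDerived.
Variables (F : fieldType) (L : lieAlgType F).
Hypothesis nilL : nilpotent_lie L.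
Local Notation Z := (center_space L).
Local Notation L2 := (derived_alg L).
Local Notation L3 := (lower_central L 2).
Implicit Types (x y : L) (X Y : seq L) (W : {vspace L}).

Lemma jacobi_derivation x y z : \[x, \[y, z]] = \[\[x, y], z] + \[y, \[x, z]].
Proof.
have /eqP := jacobi x y z; rewrite -addrA addr_eq0 => /eqP->.
rewrite opprD addrC (bracketC z \[x, y]) opprK (bracketC z x).
by rewrite -(linearN (bracket y)) /= opprK.
Qed.

Lemma bracket_span X Y W :
    (forall x y, x \in X -> y \in Y -> \[x, y] \in W) ->
  forall x y, x \in <<X>>%VS -> y \in <<Y>>%VS -> \[x, y] \in W.
Proof.
move=> XY; have extend u S v :
    (forall w, w \in S -> \[u, w] \in W) -> v \in <<S>>%VS -> \[u, v] \in W.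
  move=> uW; rewrite -[\[u, v]](lfunE (bracket u)) memv_preim; apply/subvP: v.
  by apply/span_subvP=> w /uW; rewrite -memv_preim lfunE.
move=> x y Xx Yy; apply: (extend _ _ _ _ Yy) => v Yv; rewrite bracketC rpredN.
by apply: (extend _ _ _ _ Xx) => u Xu; rewrite bracketC rpredN XY.
Qed.

(** For nilpotent $L$ this says that X generates $L$ modulo its center, by
    [subalgebra_add_derived]. *)
Definition spans_mod_derived X := (<<X>> + (L2 + Z))%VS = fullv.

Lemma spans_mod_derivedP X x : spans_mod_derived X ->
  exists u l z, [/\ u \in <<X>>%VS, l \in L2, z \in Z & x = u + l + z].
Proof.
move=> spanX; have := memvf x; rewrite -spanX.
case/memv_addP=> u Xu [_ /memv_addP[l L2l [z Zz ->]] ->].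
by exists u, l, z; rewrite addrA.
Qed.

Lemma spans_mod_derived_sub X Y :
  spans_mod_derived X -> {subset X <= <<Y>>%VS} -> spans_mod_derived Y.
Proof.
move=> spanX /span_subvP XY; apply/eqP; rewrite eqEsubv subvf -{1}spanX.
exact: addvS.
Qed.

(** Elements of $L^2 + Z$ only contribute brackets in $L^3$. *)
Lemma derived_sub_gens X W : spans_mod_derived X ->
    (forall x y, x \in X -> y \in X -> \[x, y] \in W) -> (L3 <= W)%VS ->
  (L2 <= W)%VS.
Proof.
move=> spanX XW /subvP L3W; apply/bracket_spaceP=> x y _ _.
have [u [l [z [Xu Ll Zz ->]]]] := spans_mod_derivedP x spanX.
have [u' [l' [z' [Xu' Ll' Zz' ->]]]] := spans_mod_derivedP y spanX.
rewrite bracketDr (bracket_central _ Zz') addr0 bracketDl (central_bracket _ Zz) addr0.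
rewrite bracketDr bracketDl -addrA; apply: rpredD; first exact: bracket_span Xu Xu'.
apply: rpredD; last exact/L3W/(mem_lower_centralS (k := 1)).
by rewrite bracketC rpredN; apply/L3W/(mem_lower_centralS (k := 1)).
Qed.

(** The next term $[L, L^k]$ of the series, modulo the one after it, comes from
    the brackets of generators of $L$ with generators Y of $L^k$ modulo
    $L^{k+1}$; those of $L^2$ with Y must be controlled separately. *)
Lemma lower_central_sub_gens k X Y W : spans_mod_derived X ->
    (lower_central L k <= <<Y>> + lower_central L k.+1)%VS ->
    (forall x y, x \in X -> y \in Y -> \[x, y] \in W) ->
    (forall l y, l \in L2 -> y \in Y -> \[l, y] \in W) ->
    (lower_central L k.+2 <= W)%VS ->
  (lower_central L k.+1 <= W)%VS.
Proof.
move=> spanX sY XW L2W /subvP lcW; apply/bracket_spaceP=> x y _ /(subvP sY).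
case/memv_addP=> v Yv [w lcw ->]; rewrite bracketDr rpredD //; last first.
  exact/lcW/mem_lower_centralS.
have [u [l [z [Xu Ll Zz ->]]]] := spans_mod_derivedP x spanX.
rewrite bracketDl (central_bracket _ Zz) addr0 bracketDl rpredD //.
  exact: bracket_span Xu Yv.
apply: (@bracket_span (vbasis L2) Y W) => // [l' y' /vbasis_mem L2l' Yy' |].
  exact: L2W.
by rewrite (span_basis (vbasisP L2)).
Qed.

Lemma central_of_gens X x : spans_mod_derived X ->
    (forall y, y \in X -> \[x, y] = 0) -> (forall l, l \in L2 -> \[x, l] = 0) ->
  x \in Z.
Proof.
move=> spanX xX xL2; apply/center_spaceP=> y.
have [u [l [z [Xu Ll Zz ->]]]] := spans_mod_derivedP y spanX.
rewrite !bracketDr (bracket_central _ Zz) (xL2 l Ll) !addr0; apply/eqP; rewrite -memv0.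
apply: (@bracket_span [:: x] X) => //; last exact: memv_span1.
by move=> x' y'; rewrite inE => /eqP-> /xX ->; rewrite mem0v.
Qed.

Lemma gens_complement k :
  (k + \dim (L2 + Z))%N = \dim {:L} -> exists2 X, size X = k & spans_mod_derived X.
Proof.
move=> dimL; exists (vbasis (L2 + Z)^C).
  by rewrite size_tuple dimv_compl -dimL addnK.
by rewrite /spans_mod_derived (span_basis (vbasisP _)) addvC addv_complf.
Qed.

(** With at most one generator x the subalgebra spanned by x and $Z$ is abelian
    and supplements $L^2$, hence is all of $L$. *)
Lemma two_generators : L2 != 0%VS -> (2 + \dim (L2 + Z) <= \dim {:L})%N.
Proof.
move=> L2n0.
have /gens_complement[X sizeX spanX] :
    (\dim {:L} - \dim (L2 + Z) + \dim (L2 + Z))%N = \dim {:L}.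
  by rewrite subnK // dimvS ?subvf.
rewrite leqNgt; apply: contraNN L2n0 => dimL; apply/derived_eq0P.
have X0 x y : x \in X -> y \in X -> \[x, y] = 0.
  have: (size X <= 1)%N by rewrite sizeX leq_subLR -ltnS addn1 -add2n.
  case: (X) => [|x' [|//]] _; first by rewrite in_nil.
  rewrite !inE => /eqP-> /eqP->.
  exact: bracketxx.
have bracket_XZ x y : x \in (<<X>> + Z)%VS -> y \in (<<X>> + Z)%VS -> \[x, y] = 0.
  move=> /memv_addP[u Xu [z Zz ->]] /memv_addP[v Xv [z' Zz' ->]].
  rewrite bracketDr (bracket_central _ Zz') bracketDl (central_bracket _ Zz) !addr0.
  apply/eqP; rewrite -memv0; apply: bracket_span Xu Xv => {}x {}y Xx Xy.
  by rewrite X0 ?mem0v.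
have XZ : (<<X>> + Z)%VS = fullv.
  apply: (subalgebra_add_derived nilL) => [x y XZx XZy |].
    by rewrite bracket_XZ ?mem0v.
  by rewrite -addvA [(Z + _)%VS]addvC.
by move=> x y; apply: bracket_XZ; rewrite XZ memvf.
Qed.

End GeneratorsModDerived.
(** * Nilpotent algebras with two or three generators *)

Section FewGenerators.
Variables (F : fieldType) (L : lieAlgType F).
Hypothesis nilL : nilpotent_lie L.
Local Notation Z := (center_space L).
Local Notation L2 := (derived_alg L).
(* The series is numbered from 0, with $L$ itself as the term of index 0. *)
Local Notation L3 := (lower_central L 2).
Local Notation L4 := (lower_central L 3).
Local Notation L5 := (lower_central L 4).
Implicit Types (x y c : L) (X : seq L) (W : {vspace L}).

Lemma lower_central_le_derived k : (lower_central L k.+1 <= L2)%VS.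
Proof.
elim: k => [|k IHk]; first exact: subvv.
by apply: subv_trans IHk; apply: lower_centralS.
Qed.

Lemma lower_central_last k : lower_central L k.+2 = 0%VS ->
  (\dim (lower_central L k.+1) <= \dim (L2 :&: Z))%N.
Proof.
move=> lc0; apply: dimvS; rewrite subv_cap lower_central_le_derived.
apply/subvP=> x lcx; apply/center_spaceP=> y; apply/eqP.
rewrite bracketC oppr_eq0 -memv0 -lc0.
exact: (mem_lower_centralS (k := k.+1)).
Qed.

(** The brackets of $L^2$ with c fall into $L^4$ because $[c, c] = 0$, which
    settles the condition on $L^2$ in [lower_central_sub_gens]. *)
Lemma L3_sub_gens X c W : spans_mod_derived X -> (L2 <= <[c]> + L3)%VS ->
  (forall x, x \in X -> \[x, c] \in W) -> (L4 <= W)%VS -> (L3 <= W)%VS.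
Proof.
move=> spanX L2c Xc L4W.
apply: (@lower_central_sub_gens _ _ 1 X [:: c]) => //; first by rewrite span_seq1.
  by move=> x y Xx; rewrite inE => /eqP->; apply: Xc.
move=> l y /(subvP L2c) /memv_add_lineP[a [w L3w ->]]; rewrite inE => /eqP->.
rewrite bracketDl bracketZl bracketxx scaler0 add0r bracketC rpredN.
exact/(subvP L4W)/(mem_lower_centralS (k := 2)).
Qed.

Lemma derived_pair x y :
  spans_mod_derived [:: x; y] -> (L2 <= <[\[x, y]]> + L3)%VS.
Proof.
move=> spanX; apply: (derived_sub_gens spanX) (addvSr _ _) => u v.
have cW : \[x, y] \in (<[\[x, y]]> + L3)%VS by rewrite (subvP (addvSl _ _)) ?memv_line.
rewrite !inE => /orP[] /eqP-> /orP[] /eqP->; rewrite ?bracketxx ?mem0v //.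
by rewrite bracketC rpredN.
Qed.

(** The map $x \mapsto [x, c]$ is onto the line $L^3/L^4$: one generator is
    chosen off its kernel, and the other one is corrected into it. *)
Lemma adapted_pair : (2 + \dim (L2 + Z))%N = \dim {:L} -> \dim L3 = (\dim L4).+1 ->
  exists x y, let c := \[x, y] in
  [/\ spans_mod_derived [:: x; y], (L2 <= <[c]> + L3)%VS, \[y, c] \in L4
    & L3 = (<[\[x, c]]> + L4)%VS].
Proof.
move=> dimL dimL3; have [[|y1 [|y2 []]] // _ spanX] := gens_complement dimL.
have {y1 y2 spanX} [x [y [spanX L4'x]]] :
    exists x y, spans_mod_derived [:: x; y] /\ \[x, \[x, y]] \notin L4.
  have [L4y1 | L4'y1] := boolP (\[y1, \[y1, y2]] \in L4); last by exists y1, y2.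
  have [L4y2 | L4'y2] := boolP (\[y2, \[y1, y2]] \in L4); last first.
    exists y2, y1; split; last by rewrite (bracketC y2 y1) linearN rpredN.
    apply: spans_mod_derived_sub spanX _ => u Xu; apply: memv_span.
    by rewrite !inE orbC in Xu *.
  have: (L3 <= L4)%VS.
    apply: (L3_sub_gens spanX (derived_pair spanX)) (subvv _) => u.
    by rewrite !inE => /orP[] /eqP->.
  by move/dimvS; rewrite dimL3 ltnn.
have L3E : L3 = (<[\[x, \[x, y]]]> + L4)%VS.
  apply: vline_addE => //; first exact: lower_centralS.
  exact: (mem_lower_centralS (k := 1)) (mem_derived _ _).
have /memv_add_lineP[a [w L4w ycE]] : \[y, \[x, y]] \in (<[\[x, \[x, y]]]> + L4)%VS.
  by rewrite -L3E; apply: (mem_lower_centralS (k := 1)) (mem_derived _ _).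
have brE : \[x, y - a *: x] = \[x, y].
  by rewrite bracketBr bracketZr bracketxx scaler0 subr0.
exists x, (y - a *: x); rewrite brE; split=> //.
- apply: spans_mod_derived_sub spanX _ => u; rewrite !inE => /orP[] /eqP->.
    by rewrite memv_span ?inE ?eqxx.
  by rewrite -{1}[y](subrK (a *: x)) rpredD ?memvZ ?memv_span ?inE ?eqxx ?orbT.
- exact: derived_pair.
by rewrite bracketBl bracketZl ycE addrC addKr.
Qed.

Lemma codim_gens d : (d + \dim (L2 + Z))%N = \dim {:L} ->
  (\dim {:L} + \dim (L2 :&: Z))%N = (d + \dim L2 + \dim Z)%N.
Proof. by move=> <-; rewrite -addnA dimv_sum_cap addnA. Qed.

(** Here $L^2$ is not central, so the series $L^2 > L^3 > L^4$ has dimensions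
    2, 1, 0; the basis is x, y, c = [x, y], [x, c] with [y, c] = 0. *)
Lemma isog_L_4_3 :
    (2 + \dim (L2 + Z))%N = \dim {:L} -> \dim L2 = 2%N -> \dim (L2 :&: Z) = 1%N ->
  (4 <= \dim {:L})%N /\ lie_isog L (L_4_3 F * abelian_lie F (\dim {:L} - 4))%type.
Proof.
move=> dimL dimL2 dimcap; have := codim_gens dimL; rewrite dimL2 => dimLc.
have L2n0 : L2 != 0%VS by rewrite -dimv_eq0 dimL2.
have L3n0 : L3 != 0%VS.
  apply: contra_eqN dimL2 => /eqP L3_0; rewrite neq_ltn.
  by have := @lower_central_last 0 L3_0; rewrite dimcap ltnS => ->.
have ltL32 : (\dim L3 < \dim L2)%N := lower_central_dim_lt nilL (k := 1) L2n0.
have ltL43 : (\dim L4 < \dim L3)%N := lower_central_dim_lt nilL L3n0.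
have [dimL3 /eqP dimL4] : \dim L3 = 1%N /\ \dim L4 = 0%N by lia.
rewrite dimv_eq0 in dimL4; have L4_0 := eqP dimL4.
have [||x [y [spanX L2c yc L3E]]] := adapted_pair => //; first by rewrite dimL3 L4_0 dimv0.
set c := \[x, y] in L2c yc L3E; rewrite L4_0 addv0 in L3E.
rewrite L4_0 memv0 in yc.
have L3bracket u v : v \in L3 -> \[u, v] = 0.
  by move/(mem_lower_centralS (k := 2) u); rewrite L4_0 memv0 => /eqP.
have L3xc : \[x, c] \in L3 by rewrite L3E memv_line.
apply: (@table_basis_isog _ L 3 table_4_3 _ (@jacobi_4_3 F) [:: x; y; c; \[x, c]]) => //.
- move=> [|[|[|[|i]]]] [|[|[|[|[|j]]]]] // _ _ _;
  rewrite /table_4_3 !big_cons big_nil /= ?addr0 //; try exact: L3bracket.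
  exact/eqP.
- apply: subv_trans L2c _; rewrite L3E subv_add -!memvE.
  by rewrite !memv_span ?inE ?eqxx ?orbT.
- apply: spans_mod_derived_sub spanX _ => u Xu; apply: memv_span.
  by move: Xu; rewrite !inE => /orP[] ->; rewrite ?orbT.
Qed.

Lemma derived_pair_dim :
  (2 + \dim (L2 + Z))%N = \dim {:L} -> (\dim L2 <= (\dim L3).+1)%N.
Proof.
move=> dimL; have [[|x [|y []]] // _ spanX] := gens_complement dimL.
apply: leq_trans (dimvS (derived_pair spanX)) _.
apply: leq_trans (dimv_add_leqif _ _) _.
by rewrite -(addn1 (\dim L3)) addnC leq_add2l dim_vline leq_b1.
Qed.

(** As $L^2 \cap Z$ is a line, the series starting at $L^2$ has dimensions
    3, 2, 1, 0. With c = [x, y] and e = [x, c], the Jacobi identity gives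
    [y, e] = 0 and [c, e] = 0, so the only structure constant left is a in
    [y, c] = a [x, e]. It vanishes for $L_{5,7}$, and otherwise replacing y by
    y / a turns it into 1. *)
Lemma isog_L_5_6_or_7 :
    (2 + \dim (L2 + Z))%N = \dim {:L} -> \dim L2 = 3%N -> \dim (L2 :&: Z) = 1%N ->
  (5 <= \dim {:L})%N /\
  (lie_isog L (L_5_6 F * abelian_lie F (\dim {:L} - 5))%type \/
   lie_isog L (L_5_7 F * abelian_lie F (\dim {:L} - 5))%type).
Proof.
move=> dimL dimL2 dimcap; have := codim_gens dimL; rewrite dimL2 => dimLc.
have L2n0 : L2 != 0%VS by rewrite -dimv_eq0 dimL2.
have geL3 := derived_pair_dim dimL; rewrite dimL2 ltnS in geL3.
have L3n0 : L3 != 0%VS by rewrite -dimv_eq0 -lt0n (leq_trans _ geL3).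
have ltL32 : (\dim L3 < \dim L2)%N := lower_central_dim_lt nilL (k := 1) L2n0.
have L4n0 : L4 != 0%VS.
  apply: contraTneq geL3 => L4_0; rewrite -ltnNge ltnS.
  by have := @lower_central_last 1 L4_0; rewrite dimcap.
have ltL43 : (\dim L4 < \dim L3)%N := lower_central_dim_lt nilL L3n0.
have ltL54 : (\dim L5 < \dim L4)%N := lower_central_dim_lt nilL L4n0.
have [dimL3 dimL4 /eqP dimL5] : [/\ \dim L3 = 2%N, \dim L4 = 1%N & \dim L5 = 0%N].
  by split; lia.
rewrite dimv_eq0 in dimL5; have L5_0 := eqP dimL5.
have [||x [y [spanX L2c yc L3E]]] := adapted_pair => //; first by rewrite dimL3 dimL4.
set c := \[x, y] in L2c yc L3E; set e := \[x, c] in L3E.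
have L4bracket u v : v \in L4 -> \[u, v] = 0.
  by move/(mem_lower_centralS (k := 3) u); rewrite L5_0 memv0 => /eqP.
have L3e : e \in L3 by rewrite L3E (subvP (addvSl _ _)) ?memv_line.
have ye : \[y, e] = 0.
  rewrite /e jacobi_derivation (L4bracket x) // addr0.
  rewrite bracketC (bracketC y x) linearN opprK; apply: bracketxx.
have L4xe : \[x, e] \in L4 := mem_lower_centralS (k := 2) x L3e.
have ce : \[c, e] = 0.
  have := jacobi_derivation x y e; rewrite ye bracketr0 -/c.
  by rewrite (L4bracket y) // addr0.
have L2ce : (L2 <= <<[:: c; e]>> + L4)%VS.
  by rewrite span_cons span_seq1 -addvA -L3E.
have L4xeE : L4 = <[\[x, e]]>%VS.
  have: (L4 <= <[\[x, e]]>)%VS.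
    apply: (@lower_central_sub_gens _ _ 2 [:: x; y] [:: e]) => //.
    - by rewrite span_seq1 -L3E.
    - move=> u v; rewrite !inE => /orP[] /eqP-> /eqP->; first exact: memv_line.
      by rewrite ye mem0v.
    - move=> l v /(subvP L2ce) /memv_addP[u]; rewrite span_cons span_seq1.
      case/memv_addP=> _ /vlineP[a ->] [_ /vlineP[b ->] ->] [w L4w ->].
      rewrite inE => /eqP->; rewrite !bracketDl !bracketZl ce bracketxx bracketC.
      by rewrite (L4bracket e w L4w) !scaler0 oppr0 !addr0 mem0v.
    by rewrite [X in (X <= _)%VS]L5_0 sub0v.
  move=> L4sub; apply/eqP; rewrite eqEdim L4sub dimL4 dim_vline.
  by case: (_ != 0).
have f0 : \[x, e] != 0 by apply: contraNneq L4n0 => f0; rewrite L4xeE f0.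
have [a ycE] : exists a, \[y, c] = a *: \[x, e].
  by apply/vlineP; rewrite -L4xeE.
have le5 : (5 <= \dim {:L})%N.
  have: (0 < \dim Z)%N by rewrite (leq_trans _ (dimvS (capvSr L2 Z))) ?dimcap.
  by move: dimLc; rewrite dimcap; lia.
split=> //.
have spanned (X : seq L) : x \in <<X>>%VS -> y \in <<X>>%VS -> c \in <<X>>%VS ->
    e \in <<X>>%VS -> \[x, e] \in <<X>>%VS ->
  (L2 <= <<X>>)%VS /\ (<<X>> + (L2 + Z))%VS = fullv.
  move=> Xx Xy Xc Xe Xf; split.
    apply: subv_trans L2ce _; rewrite L4xeE span_cons span_seq1 !subv_add -!memvE.
    by rewrite Xc Xe.
  by apply: spans_mod_derived_sub spanX _ => u; rewrite !inE => /orP[] /eqP->.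
have cf : \[c, \[x, e]] = 0 by apply: L4bracket.
have ef : \[e, \[x, e]] = 0 by apply: L4bracket.
have xf : \[x, \[x, e]] = 0 by apply: L4bracket.
have yf : \[y, \[x, e]] = 0 by apply: L4bracket.
have [a0 | a0] := eqVneq a 0.
  right; have [||||| L2X fullX] := spanned [:: x; y; c; e; \[x, e]];
    try by rewrite memv_span ?inE ?eqxx ?orbT.
  apply: (proj2 (@table_basis_isog _ L 4 table_5_7 _ (@jacobi_5_7 F) _ _ _ L2X fullX _)) => //.
  move=> [|[|[|[|[|i]]]]] [|[|[|[|[|[|j]]]]]] // _ _ _;
  by rewrite /table_5_7 !big_cons big_nil /= ?addr0 // ycE a0 scale0r.
left; pose k (u : L) := a^-1 *: u.
have memk (X : seq L) u : k u \in X -> u \in <<X>>%VS.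
  by move=> Xku; rewrite -[u]scale1r -(mulfV a0) -scalerA memvZ ?memv_span.
have [||||| L2X fullX] := spanned [:: x; k y; k c; k e; k \[x, e]];
  try by [rewrite memv_span ?inE ?eqxx | apply: memk; rewrite !inE !eqxx ?orbT].
apply: (proj2 (@table_basis_isog _ L 4 table_5_6 _ (@jacobi_5_6 F) _ _ _ L2X fullX _)) => //.
move=> [|[|[|[|[|i]]]]] [|[|[|[|[|[|j]]]]]] // _ _ _;
rewrite /table_5_6 !big_cons big_nil /= ?addr0 /k ?bracketZr ?bracketZl //;
rewrite ?(xf, yf, cf, ef, ye, ce) ?scaler0 //.
by rewrite ycE (scalerA _ a) mulVf // scale1r.
Qed.

Lemma derived_triple x y w : spans_mod_derived [:: x; y; w] ->
    \[x, w] \in L3 -> \[y, w] \in L3 ->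
  (L2 <= <[\[x, y]]> + L3)%VS.
Proof.
move=> spanX xw yw; apply: (derived_sub_gens spanX) (addvSr _ _) => u v.
have cW : \[x, y] \in (<[\[x, y]]> + L3)%VS by rewrite (subvP (addvSl _ _)) ?memv_line.
have L3W := subvP (addvSr <[\[x, y]]> L3).
rewrite !inE => /or3P[] /eqP-> /or3P[] /eqP->; rewrite ?bracketxx ?mem0v //;
by [apply: L3W | rewrite bracketC rpredN //; apply: L3W].
Qed.

(** Modulo $L^3$ the bracket is an alternating form with values in a line on a
    space of dimension three; such a form has a radical, spanned here by $w$. *)
Lemma radical_triple : (3 + \dim (L2 + Z))%N = \dim {:L} -> \dim L2 = (\dim L3).+1 ->
  exists x y w, [/\ spans_mod_derived [:: x; y; w], \[x, y] \notin L3,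
    \[x, w] \in L3 & \[y, w] \in L3].
Proof.
move=> dimL dimL2; have [[|y1 [|y2 [|y3 []]]] // _ spanX] := gens_complement dimL.
have {y1 y2 y3 spanX} [x [y [w [spanX L3'c]]]] :
    exists x y w, spans_mod_derived [:: x; y; w] /\ \[x, y] \notin L3.
  have [L12 | ] := boolP (\[y1, y2] \in L3); last by exists y1, y2, y3.
  have [L13 | ] := boolP (\[y1, y3] \in L3); last first.
    exists y1, y3, y2; split=> //; apply: spans_mod_derived_sub spanX _ => u.
    by rewrite !inE => /or3P[] /eqP->; rewrite memv_span // !inE eqxx ?orbT.
  have [L23 | ] := boolP (\[y2, y3] \in L3); last first.
    exists y2, y3, y1; split=> //; apply: spans_mod_derived_sub spanX _ => u.
    by rewrite !inE => /or3P[] /eqP->; rewrite memv_span // !inE eqxx ?orbT.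
  have: (L2 <= L3)%VS.
    apply: (derived_sub_gens spanX) (subvv _) => u v.
    rewrite !inE => /or3P[] /eqP-> /or3P[] /eqP->; rewrite ?bracketxx ?mem0v //;
    by rewrite bracketC rpredN.
  by move/dimvS; rewrite dimL2 ltnn.
have L2E : L2 = (<[\[x, y]]> + L3)%VS.
  by apply: vline_addE dimL2; rewrite ?mem_derived // lower_central_le_derived.
have mod_c u v : exists a, exists2 l, l \in L3 & \[u, v] = a *: \[x, y] + l.
  by apply/memv_add_lineP; rewrite -L2E mem_derived.
have [[a [l L3l xwE]] [b [l' L3l' ywE]]] := (mod_c x w, mod_c y w).
exists x, y, (w - a *: y + b *: x); split=> //.
- apply: spans_mod_derived_sub spanX _ => u; rewrite !inE => /or3P[] /eqP->.
  + by rewrite memv_span ?inE ?eqxx ?orbT.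
  + by rewrite memv_span ?inE ?eqxx ?orbT.
  + rewrite -{1}[w](subrK (a *: y)) -{1}[w - a *: y](addrK (b *: x)).
    by rewrite rpredD ?rpredB ?memvZ ?memv_span ?inE ?eqxx ?orbT.
- rewrite bracketDr bracketBr !bracketZr bracketxx scaler0 addr0 xwE.
  by rewrite addrAC subrr add0r.
- rewrite bracketDr bracketBr !bracketZr bracketxx scaler0 subr0 ywE.
  by rewrite (bracketC y x) scalerN addrAC subrr add0r.
Qed.

(** Starting from a radical vector w, the Jacobi identity gives [w, c] = 0 for
    c = [x, y]. With z = [x, c] and [y, c] = 0 one has [x, w] = a z and
    [y, w] = b z, and the fourth basis vector is (w - a c) / b. *)
Lemma isog_L_5_5 :
    (3 + \dim (L2 + Z))%N = \dim {:L} -> \dim L2 = 2%N -> \dim (L2 :&: Z) = 1%N ->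
  (5 <= \dim {:L})%N /\ lie_isog L (L_5_5 F * abelian_lie F (\dim {:L} - 5))%type.
Proof.
move=> dimL dimL2 dimcap; have := codim_gens dimL; rewrite dimL2 => dimLc.
have L2n0 : L2 != 0%VS by rewrite -dimv_eq0 dimL2.
have L3n0 : L3 != 0%VS.
  apply: contra_eqN dimL2 => /eqP L3_0; rewrite neq_ltn.
  by have := @lower_central_last 0 L3_0; rewrite dimcap ltnS => ->.
have ltL32 : (\dim L3 < \dim L2)%N := lower_central_dim_lt nilL (k := 1) L2n0.
have ltL43 : (\dim L4 < \dim L3)%N := lower_central_dim_lt nilL L3n0.
have [dimL3 /eqP dimL4] : \dim L3 = 1%N /\ \dim L4 = 0%N by lia.
rewrite dimv_eq0 in dimL4; have L4_0 := eqP dimL4.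
have L3bracket u v : v \in L3 -> \[u, v] = 0.
  by move/(mem_lower_centralS (k := 2) u); rewrite L4_0 memv0 => /eqP.
have {ltL32 ltL43} [||x [y [w [spanX L3'c xw yw]]]] := radical_triple => //.
  by rewrite dimL2 dimL3.
have wc (x' y' : L) : \[x', w] \in L3 -> \[y', w] \in L3 -> \[w, \[x', y']] = 0.
  move=> L3x' L3y'; rewrite jacobi_derivation (bracketC w y').
  rewrite (L3bracket x') ?rpredN // addr0.
  by rewrite bracketC (L3bracket y') ?oppr0 // bracketC rpredN.
(* The bracket with [x, y] is a nonzero form on the span of x and y: x is
   taken off its kernel, y in its kernel. *)
have {x y spanX L3'c xw yw} [x [y [spanX xw yw [yc xc0]]]] :
    exists x y, [/\ spans_mod_derived [:: x; y; w], \[x, w] \in L3, \[y, w] \in L3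
      & \[y, \[x, y]] = 0 /\ \[x, \[x, y]] != 0].
  have [x' [y' [spanX' x'w y'w x'c]]] :
      exists x' y', [/\ spans_mod_derived [:: x'; y'; w], \[x', w] \in L3,
        \[y', w] \in L3
        & \[x', \[x', y']] != 0].
    have [xc | ] := eqVneq (\[x, \[x, y]]) 0; last by exists x, y.
    have [yc | yc] := eqVneq (\[y, \[x, y]]) 0; last first.
      exists y, x; split=> //; last by rewrite (bracketC y x) linearN oppr_eq0.
      apply: spans_mod_derived_sub spanX _ => u.
      by rewrite !inE => /or3P[] /eqP->; rewrite memv_span // !inE eqxx ?orbT.
    have: (L3 <= 0)%VS.
      apply: (L3_sub_gens spanX (derived_triple spanX xw yw)); last by rewrite L4_0.
      by move=> u; rewrite !inE memv0 => /or3P[] /eqP->; rewrite ?xc ?yc ?wc.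
    by rewrite subv0 (negPf L3n0).
  have L3E : L3 = <[\[x', \[x', y']]]>%VS.
    apply: dim1_vline => //.
    exact: (mem_lower_centralS (k := 1)) (mem_derived _ _).
  have /vlineP[a ycE] : \[y', \[x', y']] \in <[\[x', \[x', y']]]>%VS.
    by rewrite -L3E; apply: (mem_lower_centralS (k := 1)) (mem_derived _ _).
  have brE : \[x', y' - a *: x'] = \[x', y'].
    by rewrite bracketBr bracketZr bracketxx scaler0 subr0.
  exists x', (y' - a *: x'); rewrite brE; split=> //.
  - apply: spans_mod_derived_sub spanX' _ => u; rewrite !inE => /or3P[] /eqP->.
    + by rewrite memv_span ?inE ?eqxx.
    + by rewrite -{1}[y'](subrK (a *: x')) rpredD ?memvZ ?memv_span ?inE ?eqxx ?orbT.
    + by rewrite memv_span ?inE ?eqxx ?orbT.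
  - by rewrite bracketBl bracketZl rpredB ?memvZ.
  - by rewrite bracketBl bracketZl ycE subrr.
set c := \[x, y] in yc xc0; set z := \[x, c] in xc0.
have L3E : L3 = <[z]>%VS.
  by apply: dim1_vline => //; apply: (mem_lower_centralS (k := 1)) (mem_derived _ _).
have L3z : z \in L3 by rewrite L3E memv_line.
have L2cz : (L2 <= <[c]> + <[z]>)%VS by rewrite -L3E; apply: derived_triple spanX xw yw.
have wc0 : \[w, c] = 0 by apply: wc.
have zr v : \[z, v] = 0 by rewrite bracketC L3bracket ?oppr0.
move: xw yw; rewrite L3E => /vlineP[a xwE] /vlineP[b ywE].
have b0 : b != 0.
  (* Otherwise w - a c is central and two generators suffice. *)
  apply/eqP=> b0; have Zw : w - a *: c \in Z.
    apply: (central_of_gens spanX) => [u | l /(subvP L2cz)].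
      rewrite !inE => /or3P[] /eqP->; rewrite bracketBl bracketZl.
      - by rewrite (bracketC w) (bracketC c) xwE -/z scalerN opprK addNr.
      - by rewrite (bracketC w) (bracketC c) ywE yc b0 scale0r oppr0 scaler0 subr0.
      - by rewrite bracketxx (bracketC c) wc0 oppr0 scaler0 subr0.
    case/memv_add_lineP=> k [_ /vlineP[k' ->] ->].
    rewrite bracketDr !bracketZr (L3bracket _ _ L3z) bracketBl bracketZl wc0 bracketxx.
    by rewrite !(scaler0, subr0, addr0).
  have: (fullv <= <<[:: x; y]>> + (L2 + Z))%VS.
    rewrite -spanX subv_add addvSr andbT; apply/span_subvP=> u.
    rewrite !inE => /or3P[] /eqP->; last first.
      rewrite -[w](subrK (a *: c)) addrC (subvP (addvSr _ _)) // memv_add //.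
      by rewrite memvZ ?mem_derived.
    - by rewrite (subvP (addvSl _ _)) // memv_span ?inE ?eqxx ?orbT.
    - by rewrite (subvP (addvSl _ _)) // memv_span ?inE ?eqxx ?orbT.
  move/dimvS/leq_trans/(_ (dimv_add_leqif _ _)); rewrite -dimL leq_add2r leqNgt.
  by rewrite ltnS (dim_span [:: x; y]).
pose v := b^-1 *: (w - a *: c).
have xv : \[x, v] = 0 by rewrite /v bracketZr bracketBr bracketZr xwE subrr scaler0.
have yv : \[y, v] = z.
  rewrite /v bracketZr bracketBr bracketZr yc scaler0 subr0 ywE.
  by rewrite scalerA mulVf // scale1r.
have cv : \[c, v] = 0.
  rewrite /v bracketZr bracketBr bracketZr bracketxx (bracketC c) wc0.
  by rewrite oppr0 !scaler0 subr0 scaler0.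
have le5 : (5 <= \dim {:L})%N.
  have: (0 < \dim Z)%N by rewrite (leq_trans _ (dimvS (capvSr L2 Z))) ?dimcap.
  by move: dimLc; rewrite dimcap; lia.
apply: (@table_basis_isog _ L 4 table_5_5 _ (@jacobi_5_5 F) [:: x; y; c; v; z]) => //.
- move=> [|[|[|[|[|i]]]]] [|[|[|[|[|[|j]]]]]] // _ _ _;
  rewrite /table_5_5 !big_cons big_nil /= ?addr0 ?(xv, yv, yc, cv) //;
  exact: L3bracket.
- apply: subv_trans L2cz _; rewrite subv_add -!memvE.
  by rewrite !memv_span ?inE ?eqxx ?orbT.
- apply: spans_mod_derived_sub spanX _ => u; rewrite !inE => /or3P[] /eqP->.
  + by rewrite memv_span ?inE ?eqxx ?orbT.
  + by rewrite memv_span ?inE ?eqxx ?orbT.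
  + have -> : w = b *: v + a *: c by rewrite scalerA mulfV // scale1r subrK.
    by rewrite rpredD // memvZ // memv_span // !inE eqxx ?orbT.
Qed.

End FewGenerators.
(** * Classification for small values of t *)

Section SmallValues.
Variables (F : fieldType) (L : lieAlgType F).
Hypothesis nilL : nilpotent_lie L.
Local Notation Z := (center_space L).
Local Notation L2 := (derived_alg L).

(** Equivalently $t(L) = (d-1)(m-1) + (c-1)$ with $m = \dim L^2$ and
    $c = \dim (L^2 \cap Z)$, because $\dim L/Z = d + m - c$. *)
Lemma t_formula_nonabelian : L2 != 0%VS -> exists d,
  [/\ (d + \dim (L2 + Z))%N = \dim {:L}, (1 < d)%N,
      (0 < \dim (L2 :&: Z) <= \dim L2)%N
    & t_formula L = (d.-1 * (\dim L2).-1 + (\dim (L2 :&: Z)).-1)%N].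
Proof.
move=> L2n0; exists (\dim {:L} - \dim (L2 + Z))%N.
have sum_le : (\dim (L2 + Z) <= \dim {:L})%N by rewrite dimvS ?subvf.
have Z_le : (\dim Z <= \dim {:L})%N by rewrite dimvS ?subvf.
have d_gt1 := two_generators nilL L2n0.
have c_gt0 : (0 < \dim (L2 :&: Z))%N by rewrite lt0n dimv_eq0 center_derived_neq0.
have c_le := dimvS (capvSl L2 Z).
have sumcap := dimv_sum_cap L2 Z.
split; [by rewrite subnK | by rewrite ltn_subRL addn1 -add2n | by rewrite c_gt0 | ].
rewrite /t_formula.
move: (\dim (L2 + Z)) (\dim (L2 :&: Z)) (\dim L2) (\dim Z) (\dim {:L})
  sum_le Z_le d_gt1 c_gt0 c_le sumcap => s c m z n; clear.
move=> sn zn dn c0 cm smz.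
have [d nE] : exists d, n = (d.+2 + s)%N by exists (n - s - 2)%N; lia.
have [k cE] : exists k, c = k.+1 by exists c.-1; lia.
have [l mE] : exists l, m = (l + c)%N by exists (m - c)%N; lia.
subst n c m; have -> : (d.+2 + s - s)%N = d.+2 by lia.
have -> : (d.+2 + s - z)%N = (d.+2 + l)%N by lia.
rewrite addnS /= -PoszM; apply/eqP; rewrite subr_eq -PoszD eqz_nat.
by apply/eqP; rewrite !mulSn !mulnS; lia.
Qed.

Lemma t_formula_eq0 : t_formula L = 0 ->
  lie_isog L (abelian_lie F (\dim {:L})) \/
  exists m, [/\ (1 <= m)%N, (2 * m + 1 <= \dim {:L})%N
    & lie_isog L (heisenberg F m * abelian_lie F (\dim {:L} - 2 * m - 1))%type].
Proof.
have [L2_0 _ | L2n0] := eqVneq L2 0%VS; first by left; apply: abelian_isog.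
have [d [_ d_gt1 /andP[c_gt0 c_le] ->]] := t_formula_nonabelian L2n0.
move=> [] /eqP; rewrite addn_eq0 muln_eq0 => t0.
have [m1 c1] : \dim L2 = 1%N /\ \dim (L2 :&: Z) = 1%N by lia.
right; apply: heisenberg_isog => //.
have /eqP <- : (L2 :&: Z == L2)%VS by rewrite eqEdim capvSl m1 c1.
exact: capvSr.
Qed.

Lemma t_formula_eq1 : t_formula L = 1 ->
  (4 <= \dim {:L})%N /\ lie_isog L (L_4_3 F * abelian_lie F (\dim {:L} - 4))%type.
Proof.
have [L2_0 | L2n0] := eqVneq L2 0%VS; first by rewrite t_formula_abelian.
have [d [dimL d_gt1 /andP[c_gt0 c_le] ->]] := t_formula_nonabelian L2n0.
move=> [] t1.
have [d2 m2 c1] : [/\ d = 2, \dim L2 = 2 & \dim (L2 :&: Z) = 1]%N.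
  move: (\dim L2) (\dim (L2 :&: Z)) d_gt1 c_gt0 c_le t1 => m c.
  by case: d {dimL} m c => [|[|[|d]]] [|[|[|m]]] [|[|c]] //=; split; nia.
by apply: isog_L_4_3 => //; rewrite -d2.
Qed.

Lemma t_formula_eq2 : t_formula L = 2 ->
  (5 <= \dim {:L})%N /\
  [\/ lie_isog L (L_5_5 F * abelian_lie F (\dim {:L} - 5))%type,
      lie_isog L (L_5_6 F * abelian_lie F (\dim {:L} - 5))%type
    | lie_isog L (L_5_7 F * abelian_lie F (\dim {:L} - 5))%type].
Proof.
have [L2_0 | L2n0] := eqVneq L2 0%VS; first by rewrite t_formula_abelian.
have [d [dimL d_gt1 /andP[c_gt0 c_le] ->]] := t_formula_nonabelian L2n0.
move=> [] t2.
have cases : [\/ [/\ d = 2, \dim L2 = 3 & \dim (L2 :&: Z) = 1]%N,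
    [/\ d = 3, \dim L2 = 2 & \dim (L2 :&: Z) = 1]%N
  | [/\ d = 2, \dim L2 = 2 & \dim (L2 :&: Z) = 2]%N].
  move: (\dim L2) (\dim (L2 :&: Z)) d_gt1 c_gt0 c_le t2 => m c.
  case: d {dimL} m c => [|[|[|[|d]]]] [|[|[|[|m]]]] [|[|[|c]]] //= *;
  by [constructor 1; split; nia | constructor 2; split; nia
     | constructor 3; split; nia | exfalso; nia].
case: cases => -[dE mE cE]; rewrite dE in dimL.
- by have [le5 []] := isog_L_5_6_or_7 nilL dimL mE cE => isogL; split=> //;
    [constructor 2 | constructor 3].
- by have [le5 isogL] := isog_L_5_5 nilL dimL mE cE; split=> //; constructor 1.
(* A central $L^2$ is spanned by the bracket of the two generators. *)
exfalso; have L2Z : (L2 <= Z)%VS.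
  have /eqP <- : (L2 :&: Z == L2)%VS by rewrite eqEdim capvSl mE cE.
  exact: capvSr.
have L3_0 : lower_central L 2 = 0%VS.
  apply/eqP; rewrite -subv0; apply/bracket_spaceP=> x y _ L2y.
  by rewrite bracket_central ?mem0v // (subvP L2Z).
by have := derived_pair_dim dimL; rewrite mE L3_0 dimv0.
Qed.

End SmallValues.

Theorem mainTheorem1 (F : fieldType) (L : lieAlgType F) (n d : nat)
    (n_ge1 : (1 <= n)%N) (dimL : \dim {:L} = n) (nilL : nilpotent_lie L)
    (dP : is_min_num_generators (lie_quot (lie_center L)) d) :
  [/\ t_invariant L d = 0 <->
        (lie_isog L (abelian_lie F n) \/
         exists m : nat, [/\ (1 <= m)%N, (2 * m + 1 <= n)%N &
           lie_isog L (heisenberg F m * abelian_lie F (n - 2 * m - 1))%type]),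
      t_invariant L d = 1 <->
        ((4 <= n)%N /\ lie_isog L (L_4_3 F * abelian_lie F (n - 4))%type)
    & t_invariant L d = 2 <->
        ((5 <= n)%N /\
         [\/ lie_isog L (L_5_5 F * abelian_lie F (n - 5))%type,
             lie_isog L (L_5_6 F * abelian_lie F (n - 5))%type
           | lie_isog L (L_5_7 F * abelian_lie F (n - 5))%type])].
Proof.
rewrite (t_invariantE nilL dP) -dimL; split; split.
- exact: t_formula_eq0.
- case=> [[f [bijf morphf]] | [m [m_gt0 _ isogL]]].
    apply: t_formula_abelian; apply/eqP/derived_eq0P=> x y.
    by apply: (bij_inj bijf); rewrite morphf linear0.
  by rewrite (t_formula_split isogL) t_formula_heisenberg.
- exact: t_formula_eq1.
- by case=> _ isogL; rewrite (t_formula_split isogL) t_formula_L_4_3.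
- exact: t_formula_eq2.
- by case=> _ [] isogL; rewrite (t_formula_split isogL)
    ?(t_formula_L_5_5, t_formula_L_5_6, t_formula_L_5_7).
Qed.
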